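(* Let $k\ge1$. The NilHecke algebra $\mathrm{NH}_k$ is a $\mathbb{Z}^2$-graded deformation of $\mathrm{NH}_{k,\hbar=0}$ over $\mathbb{C}[[\hbar]]_{(0,1)}$, with respect to the grading determined by $\deg(X_i)=(-1,0)$, $\deg(\sigma_i)=(1,1)$.
   Context: $\mathrm{NH}_k$ is the $\mathbb{C}[[\hbar]]$-algebra with underlying module $(\mathbb{C}[X_1,\dots,X_k]\otimes\mathbb{C}[S_k])[[\hbar]]$ (basis $X^a\sigma_w$, $a\in\mathbb{N}^k$, $w\in S_k$, $\sigma_w$ the product of generators along a reduced word of $w$), generated by $X_1,\dots,X_k,\sigma_1,\dots,\sigma_{k-1}$ with relations $X_iX_j=X_jX_i$; $\sigma_iX_i=X_{i+1}\sigma_i+\hbar$; $\sigma_iX_{i+1}=X_i\sigma_i-\hbar$; $\sigma_iX_j=X_j\sigma_i$ for $j\ne i,i+1$; $\sigma_i^2=0$; $\sigma_i\sigma_{i+1}\sigma_i=\sigma_{i+1}\sigma_i\sigma_{i+1}$; $\sigma_i\sigma_j=\sigma_j\sigma_i$ for $|i-j|\ge2$. $\mathrm{NH}_{k,\hbar=0}$ is the $\mathbb{C}$-algebra obtained by setting $\hbar=0$. $\mathbb{C}[[\hbar]]_{(0,1)}$ is $\mathbb{C}[[\hbar]]$ with the grading $\deg\hbar=(0,1)$ on all quotients $\mathbb{C}[\hbar]/\hbar^n$. A $\mathbb{Z}^2$-graded deformation over $\mathbb{C}[[\hbar]]_{(0,1)}$ of a $\mathbb{Z}^2$-graded algebra $\mathcal{A}$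 is an associative $\mathbb{C}[[\hbar]]$-bilinear product on $\mathcal{A}[[\hbar]]$ which reduces to the product of $\mathcal{A}$ modulo $\hbar$ and is homogeneous of degree $0$: for $a,b\in\mathcal{A}$ homogeneous, the $\hbar^n$-coefficient of the product of $a$ and $b$ lies in degree $\deg a+\deg b-(0,n)$. *)

(* Defs.v *)
From HB Require Import structures.
From mathcomp Require Import all_boot all_order all_algebra all_fingroup.
From mathcomp Require Import boolp functions reals.
From mathcomp Require Import complex mpoly.

Set Implicit Arguments.
Unset Strict Implicit.
Unset Printing Implicit Defensive.

Import GRing.Theory.

Local Open Scope ring_scope.

(* [fps V] is V[[hbar]]; [f n] is the coefficient of hbar^n in [f].  For a
   commutative ring C it is the ring C[[hbar]] (Cauchy product), and for a
   C-module V it is a module over C[[hbar]]. *)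
Definition fps (V : Type) : Type := nat -> V.

HB.instance Definition _ (V : zmodType) :=
  GRing.Zmodule.copy (fps V) (nat -> V).

Lemma fps_addE (V : zmodType) (f g : fps V) n : (f + g) n = f n + g n.
Proof. by []. Qed.

Definition fps_const (V : zmodType) (v : V) : fps V :=
  fun n => if n == 0%N then v else 0.

Definition fps_mul (C : comNzRingType) (f g : fps C) : fps C :=
  fun n => \sum_(i < n.+1) f i * g (n - i)%N.

Definition fps_scale (C : comNzRingType) (V : lmodType C)
    (f : fps C) (v : fps V) : fps V :=
  fun n => \sum_(i < n.+1) f i *: v (n - i)%N.

Definition hbar (C : comNzRingType) : fps C := fun n => (n == 1%N)%:R.

Lemma triangular_sum (V : zmodType) (F : nat -> nat -> nat -> V) n :
  \sum_(i < n.+1) \sum_(j < i.+1) F j (i - j)%N (n - i)%N =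
  \sum_(j < n.+1) \sum_(l < (n - j).+1) F j l (n - j - l)%N.
Proof.
transitivity (\sum_(0 <= i < n.+1) \sum_(0 <= j < n.+1 | (j <= i)%N)
    F j (i - j)%N (n - i)%N).
  rewrite big_mkord; apply: eq_bigr => i _.
  rewrite big_mkord (big_ord_widen_cond n.+1 predT
    (fun j => F j (i - j)%N (n - i)%N)) ?ltn_ord //.
rewrite (exchange_big_dep_nat predT) //= big_mkord.
apply: eq_bigr => j _; have lejn : (j <= n)%N by rewrite -ltnS.
rewrite (big_cat_nat (n := j)) //=; last exact: leqW.
rewrite big_nat_cond big_pred0 ?add0r; last first.
  by move=> i; apply/negP => /andP[/andP[_ /ltn_geF ->]].
rewrite -{1}[j : nat]add0n big_addn subSn // big_mkord.
apply: eq_big => [l|l _]; first by rewrite leq_addl.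
by rewrite addnK addnC subnDA.
Qed.

Section FpsRing.
Variable C : comNzRingType.
Implicit Types f g : fps C.

Lemma fps_mulA : associative (@fps_mul C).
Proof.
move=> f g h; apply/funext => n; rewrite /fps_mul.
under eq_bigr => i _ do rewrite mulr_sumr.
under [RHS]eq_bigr => i _ do rewrite mulr_suml.
rewrite (triangular_sum (fun a b c => f a * g b * h c)).
by apply: eq_bigr => i _; apply: eq_bigr => j _; rewrite mulrA.
Qed.

Lemma fps_mulC : commutative (@fps_mul C).
Proof.
move=> f g; apply/funext => n; rewrite /fps_mul (reindex_inj rev_ord_inj) /=.
by apply: eq_bigr => i _; rewrite mulrC subSS subKn // -ltnS.
Qed.

Lemma fps_mul1 : left_id (fps_const 1) (@fps_mul C).
Proof.
move=> f; apply/funext => n.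
by rewrite /fps_mul big_ord_recl mul1r subn0 big1 ?addr0 // => i _; rewrite mul0r.
Qed.

Lemma fps_mulDl : left_distributive (@fps_mul C) +%R.
Proof.
move=> f g h; apply/funext => n; rewrite fps_addE /fps_mul -big_split.
by apply: eq_bigr => i _; rewrite /= mulrDl.
Qed.

Lemma fps_1neq0 : fps_const 1 != 0 :> fps C.
Proof.
by apply/eqP => /(congr1 (fun f : fps C => f 0%N)) /eqP; rewrite oner_eq0.
Qed.

HB.instance Definition _ := GRing.Zmodule_isComNzRing.Build (fps C)
  fps_mulA fps_mulC fps_mul1 fps_mulDl fps_1neq0.

End FpsRing.

Section FpsLmod.
Variables (C : comNzRingType) (V : lmodType C).
Implicit Types (f g : fps C) (u v : fps V).

Lemma fps_scaleA f g v : fps_scale f (fps_scale g v) = fps_scale (f * g) v.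
Proof.
apply/funext => n; rewrite /fps_scale.
under eq_bigr => i _ do rewrite scaler_sumr.
under [RHS]eq_bigr => i _ do rewrite scaler_suml.
rewrite (triangular_sum (fun a b c => (f a * g b) *: v c)).
by apply: eq_bigr => i _; apply: eq_bigr => j _; rewrite scalerA.
Qed.

Lemma fps_scale1 : left_id 1 (@fps_scale C V).
Proof.
move=> v; apply/funext => n.
rewrite /fps_scale big_ord_recl scale1r subn0 big1 ?addr0 // => i _.
by rewrite scale0r.
Qed.

Lemma fps_scaleDr : right_distributive (@fps_scale C V) +%R.
Proof.
move=> f u v; apply/funext => n; rewrite fps_addE /fps_scale -big_split.
by apply: eq_bigr => i _; rewrite /= scalerDr.
Qed.

Lemma fps_scaleDl v : {morph (@fps_scale C V)^~ v : f g / f + g}.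
Proof.
move=> f g; apply/funext => n; rewrite fps_addE /fps_scale -big_split.
by apply: eq_bigr => i _; rewrite /= scalerDl.
Qed.

HB.instance Definition _ := GRing.Zmodule_isLmodule.Build (fps C) (fps V)
  fps_scaleA fps_scale1 fps_scaleDr fps_scaleDl.

End FpsLmod.

Definition bilinear_product (K : comNzRingType) (M : lmodType K)
    (mul : M -> M -> M) : Prop :=
  (forall a, linear (mul a)) /\ (forall b, linear (mul^~ b)).

Record is_algebra (K : comNzRingType) (M : lmodType K)
    (one : M) (mul : M -> M -> M) : Prop := IsAlgebra {
  alg_bilinear : bilinear_product mul;
  alg_assoc : associative mul;
  alg_unitl : left_id one mul;
  alg_unitr : right_id one mul
}.

(* The simple reflections s_i of S_k are indexed by i : 'I_k.-1;
   s_i exchanges [lo i] = i and [hi i] = i + 1. *)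
Section Coxeter.
Variable k : nat.

Lemma lo_subproof (i : 'I_k.-1) : (i < k)%N.
Proof. exact: leq_trans (ltn_ord i) (leq_pred k). Qed.

Lemma hi_subproof (i : 'I_k.-1) : (i.+1 < k)%N.
Proof. by rewrite -ltn_predRL. Qed.

Definition lo (i : 'I_k.-1) : 'I_k := Ordinal (lo_subproof i).
Definition hi (i : 'I_k.-1) : 'I_k := Ordinal (hi_subproof i).

Definition sref (i : 'I_k.-1) : 'S_k := tperm (lo i) (hi i).

(* The product is the one of the group 'S_k, i.e. (s * t) x = t (s x). *)
Definition word_perm (r : seq 'I_k.-1) : 'S_k := (\prod_(i <- r) sref i)%g.

Definition reduced_word (w : 'S_k) (r : seq 'I_k.-1) : Prop :=
  word_perm r = w /\
  forall r' : seq 'I_k.-1, word_perm r' = w -> (size r <= size r')%N.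

End Coxeter.

(* [e a w] is the element of M that is to be X^a sigma_w. *)
Section NilHecke.
Variables (k : nat) (K : comNzRingType) (h : K) (M : lmodType K).
Variables (e : 'X_{1..k} -> 'S_k -> M) (mul : M -> M -> M).

Definition nh_one : M := e 0%MM 1%g.
Definition nh_X (i : 'I_k) : M := e U_(i)%MM 1%g.
Definition nh_sigma (i : 'I_k.-1) : M := e 0%MM (sref i).

Local Notation "x ** y" := (mul x y) (at level 40, left associativity).
Local Notation one := nh_one.
Local Notation X := nh_X.
Local Notation sigma := nh_sigma.

Record nh_relations : Prop := NHRelations {
  nh_XX : forall i j, X i ** X j = X j ** X i;
  nh_sigma_lo : forall i, sigma i ** X (lo i) = X (hi i) ** sigma i + h *: one;
  nh_sigma_hi : forall i, sigma i ** X (hi i) = X (lo i) ** sigma i - h *: one;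
  nh_sigma_X : forall i j, j != lo i -> j != hi i ->
    sigma i ** X j = X j ** sigma i;
  nh_sigma_sq : forall i, sigma i ** sigma i = 0;
  nh_braid : forall i j : 'I_k.-1, j = i.+1 :> nat ->
    sigma i ** sigma j ** sigma i = sigma j ** sigma i ** sigma j;
  nh_sigma_comm : forall i j : 'I_k.-1, (i.+1 < j)%N || (j.+1 < i)%N ->
    sigma i ** sigma j = sigma j ** sigma i
}.

Definition nh_product (s : seq M) : M := foldr mul one s.

Definition nh_Xpow (a : 'X_{1..k}) : M :=
  nh_product (flatten [seq nseq (a i) (X i) | i <- enum 'I_k]).

(* The algebra generated by the X_i and sigma_i subject to [nh_relations], on a
   module given with its basis X^a sigma_w.  The relations rewrite every word
   in the generators into the basis, so the product is determined by them. *)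
Record is_NilHecke : Prop := IsNilHecke {
  nh_algebra : is_algebra one mul;
  nh_rel : nh_relations;
  nh_basis : forall (a : 'X_{1..k}) (w : 'S_k) (r : seq 'I_k.-1),
    reduced_word w r ->
    nh_Xpow a ** nh_product [seq sigma i | i <- r] = e a w
}.

End NilHecke.

(* C[X_1, ..., X_k] (x) C[S_k]: the summand C[X_1, ..., X_k] (x) w is the
   w-component. *)
Notation nhmod C k := {ffun 'S_k -> {mpoly C[k]}}.

Definition nh_elt (C : comNzRingType) (k : nat) (a : 'X_{1..k}) (w : 'S_k) :
    nhmod C k :=
  [ffun u => if u == w then 'X_[a] else 0].

(* [is_NH mul]: the module (C[X_1, ..., X_k] (x) C[S_k])[[hbar]] with the
   product [mul] is NH_k. *)
Definition is_NH (C : comNzRingType) (k : nat)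
    (mul : fps (nhmod C k) -> fps (nhmod C k) -> fps (nhmod C k)) : Prop :=
  is_NilHecke (hbar C) (fun a w => fps_const (nh_elt C a w)) mul.

(* [is_NH0 mul]: the module C[X_1, ..., X_k] (x) C[S_k] with the product [mul]
   is NH_k at hbar = 0. *)
Definition is_NH0 (C : comNzRingType) (k : nat)
    (mul : nhmod C k -> nhmod C k -> nhmod C k) : Prop :=
  is_NilHecke (0 : C) (@nh_elt C k) mul.

(* [gr d] is the homogeneous component of degree d of the module A. *)
Record is_Z2_grading (C : comNzRingType) (A : lmodType C) (one : A)
    (mul : A -> A -> A) (gr : int * int -> A -> Prop) : Prop := IsZ2Grading {
  gr_zero : forall d, gr d 0;
  gr_linear : forall d c a b, gr d a -> gr d b -> gr d (c *: a + b);
  gr_span : forall a, exists (s : seq (int * int)) (f : int * int -> A),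
    (forall d, gr d (f d)) /\ a = \sum_(d <- s) f d;
  gr_direct : forall (s : seq (int * int)) (f : int * int -> A),
    uniq s -> (forall d, gr d (f d)) -> \sum_(d <- s) f d = 0 ->
    forall d, d \in s -> f d = 0;
  gr_one : gr 0 one;
  gr_mul : forall d d' a b, gr d a -> gr d' b -> gr (d + d') (mul a b)
}.

(* [mul] is a deformation over C[[hbar]]_(0,1) of the graded algebra
   (A, mul0, gr). *)
Record is_Z2_graded_deformation (C : comNzRingType) (A : lmodType C)
    (mul0 : A -> A -> A) (gr : int * int -> A -> Prop)
    (mul : fps A -> fps A -> fps A) : Prop := IsZ2GradedDeformation {
  def_assoc : associative mul;
  def_bilinear : bilinear_product mul;
  def_reduces : forall a b : fps A, mul a b 0%N = mul0 (a 0%N) (b 0%N);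
  def_homogeneous : forall d d' (a b : A), gr d a -> gr d' b ->
    forall n : nat,
      gr (d + d' - (0, n%:Z)) (mul (fps_const a) (fps_const b) n)
}.

Definition is_NH_grading (C : comNzRingType) (k : nat)
    (mul0 : nhmod C k -> nhmod C k -> nhmod C k)
    (gr : int * int -> nhmod C k -> Prop) : Prop :=
  [/\ is_Z2_grading (nh_one (@nh_elt C k)) mul0 gr,
      forall i, gr (-1, 0) (nh_X (@nh_elt C k) i)
    & forall i, gr (1, 1) (nh_sigma (@nh_elt C k) i)].

(* Main.v *)
(* NH_k is realised by left multiplication operators on C[X] (x) C[S_k]:
   X_j acts by multiplication, and sigma_i sends f (x) w to
   s_i(f) (x) T_i w + hbar d_i(f) (x) w, where d_i is the divided difference
   and T_i w is s_i w if that is longer than w, and 0 otherwise.  Every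
   relation among the sigma's holds because the difference D of its two sides
   satisfies D X_j = X_{s(j)} D for a permutation s and kills all 1 (x) w.  By
   Matsumoto's theorem the operator sigma_w of a reduced word depends only on
   w, so X^a sigma_w . m defines a product; it is associative because it
   commutes with left multiplication by the generators.  Reduction modulo hbar
   gives NH_k at hbar = 0.  Conversely the relations determine the left
   multiplication by each generator on the basis, hence the product.  For the
   grading, s_i (x) T_i raises the degree by (1, 1) and d_i only by (1, 0), so
   that hbar d_i has degree (1, 1) as well. *)

Require Import Defs.
From HB Require Import structures.
From mathcomp Require Import all_boot all_order all_algebra all_fingroup.
From mathcomp Require Import boolp functions reals.
From mathcomp Require Import complex mpoly.
From mathcomp Require Import zify.

Set Implicit Arguments.
Unset Strict Implicit.
Unset Printing Implicit Defensive.

Import GRing.Theory.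

Local Open Scope ring_scope.

(** * Length and reduced words in the symmetric group *)

Section Length.
Variable k : nat.
Implicit Types (w u : 'S_k) (i j : 'I_k.-1) (r : seq 'I_k.-1).

Definition inversions w : {set 'I_k * 'I_k} :=
  [set p : 'I_k * 'I_k | (p.1 < p.2)%N && (w p.2 < w p.1)%N].

(** The inversion number plays the role of Coxeter length; [reducedP] shows that it is the minimal
    length of a word for [w]. *)
Definition ninv w : nat := #|inversions w|.

Lemma lo_neq_hi i : lo i != hi i.
Proof. by rewrite -val_eqE /= neq_ltn ltnSn. Qed.

Lemma sref_lo i : sref i (lo i) = hi i.
Proof. exact: tpermL. Qed.

Lemma sref_hi i : sref i (hi i) = lo i.
Proof. exact: tpermR. Qed.

Lemma srefK i : involutive (sref i).
Proof. exact: tpermK. Qed.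

Lemma sref_sq i : (sref i * sref i)%g = 1%g.
Proof. exact: tperm2. Qed.

Lemma mul_srefK i w : (sref i * (sref i * w))%g = w.
Proof. by rewrite mulgA sref_sq mul1g. Qed.

(** Turns identities between products of reflections into case distinctions on natural numbers. *)
Lemma val_sref i (a : 'I_k) :
  sref i a = (if a == i :> nat then i.+1 else if a == i.+1 :> nat then i : nat
              else a) :> nat.
Proof.
rewrite /sref; case: tpermP => [->|->|/eqP + /eqP] /=; rewrite ?eqxx //.
  by case: eqP => // /esym /n_Sn.
by rewrite -!val_eqE /= => /negbTE -> /negbTE ->.
Qed.

Lemma sref_braid i j : j = i.+1 :> nat ->
  (sref i * (sref j * sref i) = sref j * (sref i * sref j))%g.
Proof.
move=> ij; apply/permP => a; rewrite !permM; apply: val_inj => /=.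
by rewrite !val_sref ij; do !case: eqP => //=; lia.
Qed.

Lemma sref_comm i j : (i.+1 < j)%N || (j.+1 < i)%N ->
  (sref i * sref j = sref j * sref i)%g.
Proof.
move=> ij; apply/permP => a; rewrite !permM; apply: val_inj => /=.
by rewrite !val_sref; do !case: eqP => //=; lia.
Qed.

Lemma perm_neq_lt w (a b : 'I_k) : a != b -> (w a < w b)%N || (w b < w a)%N.
Proof. by rewrite -neq_ltn; apply: contra => /eqP /val_inj /perm_inj ->. Qed.

Lemma inv1 : ninv 1 = 0%N.
Proof.
apply/eqP; rewrite cards_eq0; apply/eqP/setP => -[a b].
by rewrite !inE !perm1 /=; lia.
Qed.

(** Since [(s * t) x = t (s x)], left multiplication by [sref i] permutes positions. The swap [g]
    preserves the order of every pair of positions except i, i+1, so exactly that pair is added to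
    the inversions. *)
Lemma inv_ascent i w :
  (w (lo i) < w (hi i))%N -> ninv (sref i * w) = (ninv w).+1.
Proof.
move=> asc; pose g (p : 'I_k * 'I_k) := (sref i p.1, sref i p.2).
have gK : involutive g by move=> [a b]; rewrite /g /= !srefK.
have -> : ninv w = #|g @^-1: inversions w|.
  rewrite /ninv (@on_card_preimset _ _ g) //; exists g => p _; exact: gK.
have nin : (lo i, hi i) \notin g @^-1: inversions w.
  by rewrite !inE /= sref_lo sref_hi /=; lia.
rewrite /ninv -[RHS]add1n.
have <- : ((lo i, hi i) \notin g @^-1: inversions w) = 1%N :> nat.
  by rewrite nin.
rewrite -cardsU1; apply: eq_card => -[a c].
rewrite !inE !permM /= xpair_eqE -!val_eqE /=.
have lo_hi (x : 'I_k) : x = i :> nat -> x = lo i by move=> xi; apply: val_inj.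
have hi_hi (x : 'I_k) : x = i.+1 :> nat -> x = hi i
  by move=> xi; apply: val_inj.
rewrite (val_sref i a) (val_sref i c).
have [ai|] := eqVneq (a : nat) i; have [ci|] := eqVneq (c : nat) i;
  have [ai'|] := eqVneq (a : nat) i.+1; have [ci'|] := eqVneq (c : nat) i.+1;
  rewrite /=; try lia.
- rewrite (lo_hi _ ai) (hi_hi _ ci') sref_lo sref_hi asc /=; lia.
- rewrite (lo_hi _ ci) (hi_hi _ ai') sref_lo sref_hi /=; lia.
Qed.

Lemma inv_descent i w :
  (w (hi i) < w (lo i))%N -> ninv w = (ninv (sref i * w)).+1.
Proof.
move=> desc; rewrite -[in LHS](mul_srefK i w) inv_ascent //.
by rewrite !permM sref_lo sref_hi.
Qed.

Lemma inv_srefP i w :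
  [/\ (w (lo i) < w (hi i))%N & ninv (sref i * w) = (ninv w).+1] \/
  [/\ (w (hi i) < w (lo i))%N & ninv w = (ninv (sref i * w)).+1].
Proof.
have /orP[lt|lt] := perm_neq_lt w (lo_neq_hi i); [left|right]; split => //.
  exact: inv_ascent.
exact: inv_descent.
Qed.

(** Such a [w] is strictly increasing, so $a \le w(a)$ by induction from the smallest position and
    $w(a) \le a$ by induction from the largest. *)
Lemma no_descent w : (forall i, w (lo i) < w (hi i))%N -> w = 1%g.
Proof.
move=> asc.
have step (a b : 'I_k) : b = a.+1 :> nat -> (w a < w b)%N.
  move=> ab; have ai : (a < k.-1)%N by rewrite ltn_predRL -ab.
  have -> : a = lo (Ordinal ai) by apply: val_inj.
  by have -> : b = hi (Ordinal ai) by apply: val_inj.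
have ge_w n (a : 'I_k) : a = n :> nat -> (a <= w a)%N.
  elim: n a => [|n IHn] a an; first by rewrite an.
  have nk : (n < k)%N by apply: leq_trans (ltn_ord a); rewrite an.
  have := IHn (Ordinal nk) erefl; have := step (Ordinal nk) a an.
  by rewrite /= an => lt le; apply: leq_ltn_trans lt.
have le_w n (a : 'I_k) : (k - a)%N = n -> (w a <= a)%N.
  elim: n a => [|n IHn] a an; first by have := ltn_ord a; lia.
  have [ak|ak] := ltnP a.+1 k; last by have := ltn_ord (w a); lia.
  have := IHn (Ordinal ak); have := step a (Ordinal ak) erefl.
  rewrite /= => lt le; rewrite -ltnS; apply: leq_trans lt _.
  by apply: le; lia.
apply/permP => a; rewrite perm1; apply: val_inj; apply/eqP.
by rewrite eqn_leq (le_w _ _ erefl) (ge_w _ _ erefl).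
Qed.

Lemma word_perm_cons i r : word_perm (i :: r) = (sref i * word_perm r)%g.
Proof. by rewrite /word_perm big_cons. Qed.

Lemma word_perm_nil : word_perm (k := k) [::] = 1%g.
Proof. by rewrite /word_perm big_nil. Qed.

Lemma inv_word_perm_le r u : (ninv (word_perm r * u) <= size r + ninv u)%N.
Proof.
elim: r => [|i r IHr]; first by rewrite word_perm_nil mul1g.
rewrite word_perm_cons -mulgA /=.
case: (inv_srefP i (word_perm r * u)) => -[_ E]; first by rewrite E addSn ltnS.
by apply: leq_trans (leqW IHr); rewrite [leqRHS]E leqnSn.
Qed.

Definition reduced w r := word_perm r = w /\ size r = ninv w.

(** Letters are split off at descents; when no descent is left, the permutation is the identity. *)
Lemma exists_reduced w : exists r, reduced w r.
Proof.
have [n] := ubnP (ninv w); elim: n => // n IHn in w *; rewrite ltnS => wn.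
have [asc|] := pselect (forall i, w (lo i) < w (hi i))%N.
  by exists [::]; rewrite /reduced (no_descent asc) word_perm_nil inv1.
move=> /existsNP[i /negP]; rewrite -leqNgt => le.
case: (inv_srefP i w) => -[lt E]; first by lia.
have [|r [rw rs]] := IHn (sref i * w)%g; first by lia.
exists (i :: r); split; first by rewrite word_perm_cons rw mul_srefK.
by rewrite /= rs -E.
Qed.

(** One letter raises the inversion number by at most one, so it bounds word lengths from below;
    [exists_reduced] attains the bound. *)
Lemma reducedP w r : reduced w r <-> reduced_word w r.
Proof.
have len_ge r' : (ninv (word_perm r') <= size r')%N.
  by have := inv_word_perm_le r' 1; rewrite mulg1 inv1 addn0.
split=> -[rw rs]; split=> //; first by move=> r' r'w; rewrite rs -r'w.
have [r0 [r0w r0s]] := exists_reduced w; have := rs _ r0w.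
by have := len_ge r; rewrite rw; lia.
Qed.

(** If [i] were an ascent of [w], then [r] would be a word for [sref i * w] with fewer letters than
    that permutation has inversions. *)
Lemma reduced_cons i w r : reduced w (i :: r) ->
  (w (hi i) < w (lo i))%N /\ reduced (sref i * w)%g r.
Proof.
rewrite /reduced word_perm_cons /= => -[rw rs].
have rw' : word_perm r = (sref i * w)%g by rewrite -rw mul_srefK.
have := inv_word_perm_le r 1; rewrite mulg1 inv1 addn0 rw'.
case: (inv_srefP i w) => -[lt E]; first by lia.
by move=> _; split => //; split => //; lia.
Qed.

Lemma cons_reduced i w r : (w (hi i) < w (lo i))%N ->
  reduced (sref i * w)%g r -> reduced w (i :: r).
Proof.
move=> desc [rw rs]; split; first by rewrite word_perm_cons rw mul_srefK.
by rewrite /= rs (inv_descent desc).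
Qed.

(* Matsumoto's theorem.  If the words start with different letters i and j,
   both are descents of w, so w also has reduced words starting with the two
   sides of the braid (or commutation) relation between i and j. *)
Lemma reduced_foldr (T : Type) (F : 'I_k.-1 -> T -> T) :
  (forall i j : 'I_k.-1, j = i.+1 :> nat ->
     forall x, F i (F j (F i x)) = F j (F i (F j x))) ->
  (forall i j : 'I_k.-1, (i.+1 < j)%N ->
     forall x, F i (F j x) = F j (F i x)) ->
  forall w r r' x, reduced w r -> reduced w r' -> foldr F x r = foldr F x r'.
Proof.
move=> Fbraid Fcomm w r r' x.
have [n] := ubnP (size r); elim: n => // n IHn in w r r' *.
have IH i v t t' : (size t < n)%N -> reduced v t -> reduced v t' ->
    F i (foldr F x t) = F i (foldr F x t').
  by move=> tn tv t'v; congr (F i _); apply: IHn tn tv t'v.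
case: r => [|i t] /=.
  by case: r' => [//|j t'] _ [_ /= E] [_ /= E']; rewrite -E in E'.
case: r' => [|j t'] /=; first by move=> _ [_ /= E] [_ /= E']; rewrite -E in E'.
rewrite ltnS => tn red red'.
have tt' : size t = size t' by case: red red' => [_ /= E1] [_ /= E2]; lia.
wlog leij : i j t t' tn red red' tt' / (i <= j)%N.
  move=> W; have [ij|ji] := leqP i j; first exact: W.
  by apply/esym/W => //; [lia|exact: ltnW].
have [desci redt] := reduced_cons red; have [descj redt'] := reduced_cons red'.
move: leij; rewrite leq_eqVlt => /orP[/eqP /val_inj ij|].
  by rewrite -ij in redt' *; apply: IH tn redt redt'.
rewrite leq_eqVlt => /orP[/eqP ij|ij].
(* Here $j = i+1$. The two descents make [w] reverse the positions i, i+1, i+2, so a reduced word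
   [s] of $s_is_js_iw$ extends to reduced words $j,i,s$ of $s_iw$ and $i,j,s$ of $s_jw$. The words
   $i,j,i,s$ and $j,i,j,s$ of [w] are then linked by the braid relation. *)
- have [s reds] := exists_reduced (sref i * (sref j * (sref i * w)))%g.
  have hilo : hi i = lo j by apply: val_inj; rewrite /= ij.
  rewrite -hilo in descj.
  have hi_hij : sref j (hi i) = hi j by rewrite hilo sref_lo.
  have hij_hi : sref j (hi j) = hi i by rewrite hilo sref_hi.
  have loi_hij : sref j (lo i) = lo i.
    by apply: val_inj; rewrite /= val_sref /= -ij; do !case: eqP; lia.
  have hij_i : sref i (hi j) = hi j.
    by apply: val_inj; rewrite /= val_sref /= -ij; do !case: eqP; lia.
  have redji : reduced (sref i * w)%g [:: j, i & s].
    apply: cons_reduced; first by rewrite !permM hij_i -hilo sref_hi; lia.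
    apply: cons_reduced => //.
    by rewrite !permM loi_hij hi_hij hij_i sref_lo.
  have redij : reduced (sref j * w)%g [:: i, j & s].
    apply: cons_reduced; first by rewrite !permM loi_hij hi_hij; lia.
    apply: cons_reduced; last first.
      have /(congr1 (fun x => x * w)%g) := sref_braid (esym ij).
      by rewrite /= -!mulgA => <-.
    by rewrite !permM -hilo hij_i hij_hi sref_hi loi_hij.
  rewrite (IH i _ _ _ tn redt redji) (IH j _ _ _ _ redt' redij) -?tt' //=.
  exact: Fbraid.
(* Now the letters are at distance at least two: the same argument runs with $s_js_iw$ and the
   commutation relation. *)
- have [s reds] := exists_reduced (sref j * (sref i * w))%g.
  have commij : (sref i * sref j = sref j * sref i)%g by rewrite sref_comm ?ij.
  have [eloi ehii] : sref j (lo i) = lo i /\ sref j (hi i) = hi i.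
    by split; apply: val_inj; rewrite /= val_sref /=; do !case: eqP; lia.
  have [eloj ehij] : sref i (lo j) = lo j /\ sref i (hi j) = hi j.
    by split; apply: val_inj; rewrite /= val_sref /=; do !case: eqP; lia.
  have redj : reduced (sref i * w)%g (j :: s).
    by apply: cons_reduced => //; rewrite !permM eloj ehij.
  have redi : reduced (sref j * w)%g (i :: s).
    apply: cons_reduced; first by rewrite !permM eloi ehii.
    by rewrite mulgA commij -mulgA.
  rewrite (IH i _ _ _ tn redt redj) (IH j _ _ _ _ redt' redi) -?tt' //=.
  exact: Fcomm.
Qed.

End Length.

(** * Linear maps given by the predicate [linear] *)

Section PropLinear.
Variables (K : comNzRingType) (M N : lmodType K) (f : M -> N).
Hypothesis linf : linear f.

Lemma linear_propD u v : f (u + v) = f u + f v.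
Proof. by have := linf 1 u v; rewrite !scale1r. Qed.

Lemma linear_prop0 : f 0 = 0.
Proof. by apply: (addrI (f 0)); rewrite -linear_propD !addr0. Qed.

Lemma linear_propZ c u : f (c *: u) = c *: f u.
Proof. by have := linf c u 0; rewrite linear_prop0 !addr0. Qed.

Lemma linear_prop_sum (I : Type) (r : seq I) (P : pred I) (F : I -> M) :
  f (\sum_(i <- r | P i) F i) = \sum_(i <- r | P i) f (F i).
Proof. exact: (big_morph f linear_propD linear_prop0). Qed.

End PropLinear.

Lemma linear_comp (K : comNzRingType) (L M N : lmodType K)
    (f : M -> N) (g : L -> M) : linear f -> linear g -> linear (f \o g).
Proof. by move=> lf lg c u v /=; rewrite lg lf. Qed.

Lemma linear_cst0 (K : comNzRingType) (M N : lmodType K) :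
  linear (fun _ : M => 0 : N).
Proof. by move=> c u v; rewrite scaler0 addr0. Qed.

Lemma linear_foldr (K : comNzRingType) (M : lmodType K) (T : Type)
    (F : T -> M -> M) r :
  (forall x, linear (F x)) -> linear (foldr F ^~ r).
Proof.
by move=> lF; elim: r => [|x r IHr] c u v //=; rewrite IHr lF.
Qed.

(** * Products satisfying the nilHecke relations *)

Section Relations.
Variables (k : nat) (K : comNzRingType) (h : K).

(** The correction term that merges the three relations between $\sigma_i$ and $X_j$ into one,
    [nh_sigmaX]. For $h = 1$ it is the divided difference of $X_j$. *)
Definition nh_delta (i : 'I_k.-1) (j : 'I_k) : K :=
  if j == lo i then h else if j == hi i then - h else 0.

Lemma nh_delta_lo i : nh_delta i (lo i) = h.
Proof. by rewrite /nh_delta eqxx. Qed.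

Lemma nh_delta_hi i : nh_delta i (hi i) = - h.
Proof. by rewrite /nh_delta eq_sym (negbTE (lo_neq_hi i)) eqxx. Qed.

Lemma nh_delta_neq i j : j != lo i -> j != hi i -> nh_delta i j = 0.
Proof. by rewrite /nh_delta => /negbTE-> /negbTE->. Qed.

Lemma sref_neq (i : 'I_k.-1) (j : 'I_k) :
  j != lo i -> j != hi i -> sref i j = j.
Proof. by move=> jl jh; rewrite /sref tpermD // eq_sym. Qed.

Section Product.
Variables (M : lmodType K) (e : 'X_{1..k} -> 'S_k -> M) (mul : M -> M -> M).

Local Notation "x ** y" := (mul x y) (at level 40, left associativity).
Local Notation one := (nh_one e).
Local Notation X := (nh_X e).
Local Notation sigma := (nh_sigma e).

Lemma nh_sigmaX (rel : nh_relations h e mul) i j :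
  sigma i ** X j = X (sref i j) ** sigma i + nh_delta i j *: one.
Proof.
have [->|jl] := eqVneq j (lo i).
  by rewrite sref_lo nh_delta_lo (nh_sigma_lo rel).
have [->|jh] := eqVneq j (hi i).
  by rewrite sref_hi nh_delta_hi (nh_sigma_hi rel) scaleNr.
by rewrite sref_neq // nh_delta_neq // scale0r addr0 (nh_sigma_X rel).
Qed.

Lemma nh_product_mul (alg : is_algebra one mul) s m :
  nh_product e mul s ** m = foldr mul m s.
Proof.
elim: s => [|x s IHs] /=; first exact: (alg_unitl alg).
by rewrite -(alg_assoc alg) IHs.
Qed.

(** [X j] commutes past the powers of the other variables until it joins its own block, which occurs
    once because [s] is duplicate-free. Only commutation of the [X i] is assumed, so that the lemma
    also serves in the construction of the product. *)
Lemma nh_product_X (alg : is_algebra one mul)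
    (XX : forall i j, X i ** X j = X j ** X i)
    j (b : 'X_{1..k}) (s : seq 'I_k) :
  uniq s -> j \in s ->
  X j ** nh_product e mul (flatten [seq nseq (b i) (X i) | i <- s]) =
  nh_product e mul (flatten [seq nseq ((U_(j) + b)%MM i) (X i) | i <- s]).
Proof.
pose P a s := nh_product e mul (flatten [seq nseq (a i) (X i) | i <- s]).
have Pcons (a : 'X_{1..k}) i t : P a (i :: t) = iter (a i) (mul (X i)) (P a t).
  rewrite /P /nh_product /= foldr_cat.
  by elim: (a i) => //= n ->.
have Xiter i n m : X j ** iter n (mul (X i)) m = iter n (mul (X i)) (X j ** m).
  elim: n => //= n IHn.
  by rewrite (alg_assoc alg) XX -(alg_assoc alg) IHn.
rewrite -[LHS]/(_ ** P b s) -[RHS]/(P _ s).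
elim: s => // i s IHs /= /andP[is_ us]; rewrite inE !Pcons Xiter.
case: (eqVneq j i) is_ => [<-{i} is_ _|ji is_ /= js].
  rewrite mnmDE mnm1E eqxx add1n iterSr.
  congr (iter _ _ (X j ** _)); rewrite /P; congr (nh_product _ _ (flatten _)).
  apply/eq_in_map => i is'; rewrite mnmDE mnm1E.
  by case: eqP is' is_ => // -> ->.
by rewrite IHs // mnmDE mnm1E (negbTE ji).
Qed.

Section NilHecke.
Hypothesis NH : is_NilHecke h e mul.
Let alg := nh_algebra NH.
Let rel := nh_rel NH.

Lemma nh_Xpow0 : nh_Xpow e mul 0%MM = one.
Proof.
rewrite /nh_Xpow; set s := flatten _; suff -> : s = [::] by [].
by rewrite /s; elim: (enum _) => //= i r ->; rewrite mnm0E.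
Qed.

Lemma nh_X_basis j b u : X j ** e b u = e (U_(j) + b)%MM u.
Proof.
have [r /reducedP red] := exists_reduced u.
rewrite -!(nh_basis NH _ red) (alg_assoc alg); congr (_ ** _).
apply: (nh_product_X alg (nh_XX rel)); first exact: enum_uniq.
by rewrite mem_enum.
Qed.

Lemma nh_sigma_word u r : reduced u r ->
  e 0%MM u = nh_product e mul [seq sigma i | i <- r].
Proof.
move=> /reducedP red.
by rewrite -(nh_basis NH _ red) nh_Xpow0 (alg_unitl alg).
Qed.

(** At an ascent, prefixing [i] keeps a reduced word reduced. At a descent, [u] has a reduced word
    beginning with [i], and $\sigma_i^2 = 0$ applies. *)
Lemma nh_sigma_basis0 i u :
  sigma i ** e 0%MM u =
  if (ninv u < ninv (sref i * u))%N then e 0%MM (sref i * u)%g else 0.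
Proof.
have [r red] := exists_reduced u.
case: (inv_srefP i u) => -[lt E].
  have red' : reduced (sref i * u)%g (i :: r).
    apply: cons_reduced; first by rewrite !permM sref_lo sref_hi.
    by rewrite mul_srefK.
  by rewrite E ltnSn (nh_sigma_word red) (nh_sigma_word red').
rewrite E ltnNge leqnSn /=.
have [t redt] := exists_reduced (sref i * u)%g.
rewrite (nh_sigma_word (cons_reduced lt redt)) /= (alg_assoc alg).
rewrite (nh_sigma_sq rel).
exact: (linear_prop0 (proj2 (alg_bilinear alg) _)).
Qed.

End NilHecke.
End Product.

Lemma mnm_ind (P : 'X_{1..k} -> Prop) :
  P 0%MM -> (forall j a, P a -> P (U_(j) + a)%MM) -> forall a, P a.
Proof.
move=> P0 PS a; have [n] := ubnP (mdeg a); elim: n => // n IHn in a *.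
rewrite ltnS => an; have [->//|/eqP] := eqVneq a 0%MM.
have [/existsP[j aj] _|/existsPn a0 []] := boolP [exists j, a j != 0%N].
  have le : (U_(j) <= a)%MM.
    apply/mnm_lepP => i; rewrite mnm1E.
    by case: (j =P i) aj => [<-|//]; rewrite lt0n.
  rewrite -(submK le) addmC; apply: PS; apply: IHn.
  by move: an; rewrite -{1}(submK le) mdegD mdeg1 addn1.
by apply/mnmP => i; rewrite mnm0E; have /negPn/eqP := a0 i.
Qed.

(* The relations let one compute left multiplication by each generator on the
   basis, hence the whole product. *)
Lemma NilHecke_unique (M : lmodType K) (e : 'X_{1..k} -> 'S_k -> M)
    (mul mul' : M -> M -> M) :
  (forall f g : M -> M, linear f -> linear g ->
     (forall a w, f (e a w) = g (e a w)) -> f = g) ->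
  is_NilHecke h e mul -> is_NilHecke h e mul' -> mul = mul'.
Proof.
move=> ext NH NH'.
have [[linl linr] assoc _ _] := nh_algebra NH.
have [[linl' linr'] assoc' _ _] := nh_algebra NH'.
have EX j : mul (nh_X e j) = mul' (nh_X e j).
  by apply: ext => // a w; rewrite (nh_X_basis NH) (nh_X_basis NH').
(* Moving one variable at a time to the left of $\sigma_i$ reduces the claim to [a = 0]. *)
have Es i : mul (nh_sigma e i) = mul' (nh_sigma e i).
  apply: ext => // a w; elim/mnm_ind: a => [|j a IHa].
    by rewrite (nh_sigma_basis0 NH) (nh_sigma_basis0 NH').
  rewrite -{1}(nh_X_basis NH) -(nh_X_basis NH') assoc assoc'.
  rewrite (nh_sigmaX (nh_rel NH)) (nh_sigmaX (nh_rel NH')).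
  rewrite (linear_propD (linr _)) (linear_propD (linr' _)).
  rewrite (linear_propZ (linr _)) (linear_propZ (linr' _)).
  rewrite (alg_unitl (nh_algebra NH)) (alg_unitl (nh_algebra NH')).
  by rewrite -assoc -assoc' IHa EX.
apply/funext => x; apply/funext => y.
(* Basis elements suffice in the first factor. Such an element is a product of generators, so both
   products act on [y] by the same successive left multiplications. *)
suff /(congr1 (@^~ x)) : mul^~ y = mul'^~ y by [].
apply: ext => // a w.
have [r /reducedP red] := exists_reduced w.
rewrite -{1}(nh_basis NH _ red) -(nh_basis NH' _ red) -assoc -assoc'.
rewrite !(nh_product_mul (nh_algebra NH)) !(nh_product_mul (nh_algebra NH')).
have -> : foldr mul y [seq nh_sigma e i | i <- r]
  = foldr mul' y [seq nh_sigma e i | i <- r].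
  by elim: (r) => //= i s ->; rewrite Es.
elim: (enum _) => //= i s; rewrite !foldr_cat => ->.
by elim: (a i) => //= n ->; rewrite EX.
Qed.

End Relations.

(** * Divided differences *)

Section DividedDifference.
Variables (C : idomainType) (k : nat).
Implicit Types (f g : {mpoly C[k]}) (i : 'I_k.-1).

Lemma msym_X (s : 'S_k) j : msym s ('X_j : {mpoly C[k]}) = 'X_(s j).
Proof. by rewrite /msym mmapX mmap1U. Qed.

Lemma mpoly_X_ind (P : {mpoly C[k]} -> Prop) :
  P 1 -> (forall j f, P f -> P ('X_j * f)) ->
  (forall c f g, P f -> P g -> P (c *: f + g)) -> forall f, P f.
Proof.
move=> P1 PX PD; elim/mpolyind => [|c m f _ _ Pf].
  (* The zero polynomial is obtained as $(-1)\cdot 1 + 1$. *)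
  by rewrite -(addNr 1) -scaleN1r; apply: PD.
apply: PD => //; elim/mnm_ind: m => [|j a Pa]; first by rewrite mpolyX0.
by rewrite mpolyXD; apply: PX.
Qed.

Lemma X_sub_neq0 i : 'X_(lo i) - 'X_(hi i) != 0 :> {mpoly C[k]}.
Proof.
apply/eqP => /(congr1 (mcoeff U_(lo i))).
rewrite mcoeffB mcoeff0 !mcoeffX eqxx eq_mnm1 eq_sym (negbTE (lo_neq_hi i)).
by move/eqP; rewrite subr0 oner_eq0.
Qed.

Lemma X_sub_sref i j :
  ('X_(lo i) - 'X_(hi i)) * (nh_delta 1 i j)%:MP = 'X_j - 'X_(sref i j)
    :> {mpoly C[k]}.
Proof.
have [->|jl] := eqVneq j (lo i).
  by rewrite nh_delta_lo sref_lo mpolyC1 mulr1.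
have [->|jh] := eqVneq j (hi i).
  by rewrite nh_delta_hi sref_hi mpolyCN mpolyC1 mulrN1 opprB.
by rewrite nh_delta_neq // sref_neq // mpolyC0 mulr0 subrr.
Qed.

(** The quotient is built one variable at a time by the twisted Leibniz rule $d_i(X_jf) =
    X_{s_i(j)}d_i(f) + d_i(X_j)f$. *)
Lemma divdiff_exists i f :
  exists g, ('X_(lo i) - 'X_(hi i)) * g = f - msym (sref i) f.
Proof.
elim/mpoly_X_ind: f => [|j f [g gE]|c f f' [g gE] [g' gE']].
- by exists 0; rewrite mulr0 msym1 subrr.
- exists ('X_(sref i j) * g + (nh_delta 1 i j)%:MP * f).
  rewrite mulrDr mulrCA gE mulrA X_sub_sref msymM msym_X mulrBr mulrBl.
  by rewrite addrC addrA subrK.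
- exists (c *: g + g').
  by rewrite mulrDr -scalerAr gE gE' msymD msymZ scalerBr opprD addrACA.
Qed.

Definition divdiff i f : {mpoly C[k]} := sval (cid (divdiff_exists i f)).

Lemma divdiffE i f :
  ('X_(lo i) - 'X_(hi i)) * divdiff i f = f - msym (sref i) f.
Proof. exact: (svalP (cid (divdiff_exists i f))). Qed.

(** Polynomials over an integral domain form a domain, so $X_i - X_{i+1}$ cancels and the choice
    made in [divdiff] is harmless. *)
Lemma divdiff_unique i f g :
  ('X_(lo i) - 'X_(hi i)) * g = f - msym (sref i) f -> divdiff i f = g.
Proof. by rewrite -divdiffE => /(mulfI (X_sub_neq0 i)). Qed.

Lemma divdiff1 i : divdiff i 1 = 0.
Proof. by apply: divdiff_unique; rewrite mulr0 msym1 subrr. Qed.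

Lemma divdiff_linear i : linear (divdiff i).
Proof.
move=> c f g; apply: divdiff_unique.
by rewrite mulrDr -scalerAr !divdiffE msymD msymZ scalerBr opprD addrACA.
Qed.

Lemma divdiffX i j f :
  divdiff i ('X_j * f) = 'X_(sref i j) * divdiff i f + nh_delta 1 i j *: f.
Proof.
apply: divdiff_unique; rewrite -mul_mpolyC.
rewrite mulrDr mulrCA divdiffE mulrA X_sub_sref msymM msym_X mulrBr mulrBl.
by rewrite addrC addrA subrK.
Qed.

End DividedDifference.

(** * The action of the generators *)

Section Module.
Variables (C : idomainType) (k : nat).
Local Notation V := (nhmod C k).
Local Notation e := (@nh_elt C k).
Implicit Types (u v : V) (w : 'S_k) (i : 'I_k.-1) (p : {mpoly C[k]}).

Lemma nhmod_sum v :
  v = \sum_w \sum_(a <- msupp (v w)) (v w)@_a *: e a w.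
Proof.
apply/ffunP => w; rewrite sum_ffunE (bigD1 w) //=.
rewrite [X in _ + X]big1 ?addr0 => [|w' /negbTE ne].
  by rewrite sum_ffunE [LHS]mpolyE; apply: eq_bigr => a _; rewrite !ffunE eqxx.
by rewrite sum_ffunE big1 // => a _; rewrite !ffunE eq_sym ne scaler0.
Qed.

(** Basis elements are required to satisfy [P] only when they occur in [v]; this makes the principle
    applicable to homogeneous elements in [nh_gr_ind]. *)
Lemma nhmod_ind (P : V -> Prop) v :
  P 0 -> (forall c u u', P u -> P u' -> P (c *: u + u')) ->
  (forall a w, (v w)@_a != 0 -> P (e a w)) -> P v.
Proof.
move=> P0 PD Pe.
have PA u u' : P u -> P u' -> P (u + u').
  by move=> Pu Pu'; rewrite -[u]scale1r; apply: PD.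
rewrite (nhmod_sum v); apply: (big_ind P) => // w _.
rewrite big_seq; apply: (big_ind P) => // a; rewrite mcoeff_msupp => va.
by rewrite -[_ *: _]addr0; apply: PD => //; apply: Pe.
Qed.

Lemma nhmod_ext (M : lmodType C) (f g : V -> M) :
  linear f -> linear g -> (forall a w, f (e a w) = g (e a w)) -> f = g.
Proof.
move=> lf lg fg; apply/funext => v.
apply: (@nhmod_ind (fun v => f v = g v)) => // [|c u u' uE uE'].
  by rewrite !linear_prop0.
by rewrite lf lg uE uE'.
Qed.

Definition poly_act p v : V := [ffun w => p * v w].

(** The operator $s_i \otimes T_i$ read off at the target: the component at [w] comes from
    [sref i * w], provided that is shorter. *)
Definition twist i v : V :=
  [ffun w => if (ninv (sref i * w) < ninv w)%N
             then msym (sref i) (v (sref i * w)%g) else 0].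

Definition diff_act i v : V := [ffun w => divdiff i (v w)].

Lemma poly_act_linear p : linear (poly_act p).
Proof. by move=> c u v; apply/ffunP => w; rewrite !ffunE mulrDr scalerAr. Qed.

Lemma poly_act_linearl v : linear (poly_act ^~ v).
Proof. by move=> c p q; apply/ffunP => w; rewrite !ffunE mulrDl scalerAl. Qed.

Lemma poly_act1 v : poly_act 1 v = v.
Proof. by apply/ffunP => w; rewrite !ffunE mul1r. Qed.

Lemma poly_actM p q v : poly_act (p * q) v = poly_act p (poly_act q v).
Proof. by apply/ffunP => w; rewrite !ffunE mulrA. Qed.

Lemma poly_act_elt b a w : poly_act 'X_[b] (e a w) = e (b + a)%MM w.
Proof.
apply/ffunP => u; rewrite !ffunE mpolyXD.
by case: eqP => // _; rewrite mulr0.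
Qed.

Lemma twist_linear i : linear (twist i).
Proof.
move=> c u v; apply/ffunP => w; rewrite !ffunE.
by case: ifP => _; rewrite ?scaler0 ?addr0 // msymD msymZ.
Qed.

Lemma twistX i j v :
  twist i (poly_act 'X_j v) = poly_act 'X_(sref i j) (twist i v).
Proof.
apply/ffunP => w; rewrite !ffunE.
by case: ifP => _; rewrite ?mulr0 // msymM msym_X.
Qed.

Lemma twist_elt0 i w :
  twist i (e 0%MM w) =
  if (ninv w < ninv (sref i * w))%N then e 0%MM (sref i * w)%g else 0.
Proof.
apply/ffunP => u; rewrite [LHS]ffunE.
have -> : (if (ninv w < ninv (sref i * w))%N then e 0 (sref i * w)%g else 0) u
  = if (ninv w < ninv (sref i * w))%N then e 0%MM (sref i * w)%g u else 0.
  by case: ifP; rewrite ?ffunE.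
rewrite !ffunE mpolyX0.
have [->|] := eqVneq u (sref i * w)%g; first by rewrite mul_srefK eqxx msym1.
have [<-|_ _] := eqVneq (sref i * u)%g w; first by rewrite mul_srefK eqxx.
by rewrite msym0 !if_same.
Qed.

Lemma diff_act_linear i : linear (diff_act i).
Proof. by move=> c u v; apply/ffunP => w; rewrite !ffunE divdiff_linear. Qed.

Lemma diff_actX i j v :
  diff_act i (poly_act 'X_j v) =
  poly_act 'X_(sref i j) (diff_act i v) + nh_delta 1 i j *: v.
Proof. by apply/ffunP => w; rewrite !ffunE divdiffX. Qed.

Lemma diff_act_elt0 i w : diff_act i (e 0%MM w) = 0.
Proof.
apply/ffunP => u; rewrite !ffunE mpolyX0.
case: ifP => _; first exact: divdiff1.
exact: (linear_prop0 (@divdiff_linear C k i)).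
Qed.

End Module.

(** * Power series with coefficients in a module *)

Section Fps.
Variable C : comNzRingType.

Lemma fps_scaleE (V : lmodType C) (c : fps C) (f : fps V) n :
  (c *: f) n = \sum_(i < n.+1) c i *: f (n - i)%N.
Proof. by []. Qed.

Lemma fps_const_scaleE (V : lmodType C) (c : C) (f : fps V) n :
  ((fps_const c : fps C) *: f) n = c *: f n.
Proof.
rewrite fps_scaleE big_ord_recl subn0 big1 ?addr0 // => i _.
by rewrite scale0r.
Qed.

Lemma hbar_scaleE (V : lmodType C) (f : fps V) n :
  (hbar C *: f) n = if n is m.+1 then f m else 0.
Proof.
rewrite fps_scaleE big_ord_recl scale0r add0r.
case: n => [|n]; first by rewrite big_ord0.
rewrite big_ord_recl scale1r subn1 big1 ?addr0 // => i _.
by rewrite scale0r.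
Qed.

Lemma fps_const_linear (V : lmodType C) c (u v : V) :
  fps_const (c *: u + v) = (fps_const c : fps C) *: fps_const u + fps_const v
    :> fps V.
Proof.
apply/funext => n; rewrite fps_addE fps_const_scaleE /fps_const.
by case: n => //= _; rewrite scaler0 addr0.
Qed.

Lemma fps_const0 (V : zmodType) : fps_const 0 = 0 :> fps V.
Proof. by apply/funext => n; rewrite /fps_const; case: ifP. Qed.

Lemma fps_split (V : lmodType C) (f : fps V) :
  f = fps_const (f 0%N) + hbar C *: (f \o S : fps V).
Proof.
apply/funext => n; rewrite fps_addE hbar_scaleE /fps_const.
by case: n => [|n] /=; rewrite ?addr0 ?add0r.
Qed.

(** Linearity over $\mathbb{C}[[\hbar]]$ already gives $\hbar$-adic continuity: splitting off the
    terms up to $\hbar^n$ leaves a multiple of $\hbar^{n+1}$, whose image has no coefficient at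
    $\hbar^n$. *)
Lemma fps_linear_coef (V W : lmodType C) (F : fps V -> fps W) (f : fps V) n :
  linear F -> F f n = \sum_(i < n.+1) F (fps_const (f i)) (n - i)%N.
Proof.
move=> linF; elim: n f => [|n IHn] f; rewrite {1}[f]fps_split.
all: rewrite (linear_propD linF) (linear_propZ linF) fps_addE hbar_scaleE.
  by rewrite big_ord_recl big_ord0.
by rewrite IHn [RHS]big_ord_recl.
Qed.

Lemma fps_linear_ext (V W : lmodType C) (F G : fps V -> fps W) :
  linear F -> linear G ->
  (forall v, F (fps_const v) = G (fps_const v)) -> F = G.
Proof.
move=> linF linG FG; apply/funext => f; apply/funext => n.
rewrite (fps_linear_coef _ _ linF) (fps_linear_coef _ _ linG).
by apply: eq_bigr => i _; rewrite FG.
Qed.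

Definition fps_map (V W : Type) (F : V -> W) (f : fps V) : fps W := F \o f.

Lemma fps_map_linear (V W : lmodType C) (F : V -> W) :
  linear F -> linear (fps_map F : fps V -> fps W).
Proof.
move=> linF c f g; apply/funext => n.
rewrite /fps_map /= fps_addE (linear_propD linF) fps_addE; congr (_ + _).
rewrite !fps_scaleE (linear_prop_sum linF).
by apply: eq_bigr => i _; rewrite (linear_propZ linF).
Qed.

Lemma fps_map_const (V W : lmodType C) (F : V -> W) v :
  linear F -> fps_map F (fps_const v) = fps_const (F v).
Proof.
move=> linF; apply/funext => n; rewrite /fps_map /fps_const /=.
by case: ifP => // _; rewrite (linear_prop0 linF).
Qed.

End Fps.

(** * The operators of the generators over $\mathbb{C}[[\hbar]]$ and their relations *)

HB.lock Definition left_sigma (C : idomainType) (k : nat) (i : 'I_k.-1)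
    (f : fps (nhmod C k)) : fps (nhmod C k) :=
  fps_map (@twist C k i) f + hbar C *: fps_map (@diff_act C k i) f.

Section Operators.
Variables (C : idomainType) (k : nat).
Local Notation V := (nhmod C k).
Local Notation M := (fps V).
Local Notation E := (fun a w => fps_const (nh_elt C a w) : M).
Local Notation left_sigma := (@left_sigma C k).
Local Notation delta := (@nh_delta k (fps C) (hbar C)).
Implicit Types (f g : M) (w : 'S_k) (i : 'I_k.-1) (p : {mpoly C[k]}).

(** Finite combinations of the [E a w] do not reach every series in general, but they reach the
    constant ones, and these determine a linear map by [fps_linear_ext]. *)
Lemma nhfps_ext (F G : M -> M) : linear F -> linear G ->
  (forall a w, F (E a w) = G (E a w)) -> F = G.
Proof.
move=> linF linG FG; apply: fps_linear_ext => // v.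
apply: (@nhmod_ind C k (fun v => F (fps_const v) = G (fps_const v))) => //.
  by rewrite fps_const0 !linear_prop0.
by move=> c u u' uE uE'; rewrite !fps_const_linear linF linG uE uE'.
Qed.

Definition left_poly p : M -> M := fps_map (poly_act p).

Lemma left_poly_linear p : linear (left_poly p).
Proof. exact/fps_map_linear/poly_act_linear. Qed.

Lemma left_sigma_linear i : linear (left_sigma i).
Proof.
have lin1 := fps_map_linear (@twist_linear C k i).
have lin2 := fps_map_linear (@diff_act_linear C k i).
move=> c f g; rewrite left_sigma.unlock lin1 lin2 scalerDr scalerDr !scalerA.
by rewrite [hbar C * c]mulrC addrACA.
Qed.

Lemma left_poly1 f : left_poly 1 f = f.
Proof. by apply/funext => n; rewrite /left_poly /fps_map /= poly_act1. Qed.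

Lemma left_polyM p q f : left_poly (p * q) f = left_poly p (left_poly q f).
Proof. by apply/funext => n; rewrite /left_poly /fps_map /= poly_actM. Qed.

Lemma left_poly_elt b a w : left_poly 'X_[b] (E a w) = E (b + a)%MM w.
Proof.
by rewrite /left_poly fps_map_const ?poly_act_elt //; apply: poly_act_linear.
Qed.

(** The twist passes $X_j$ without remainder; the remainder comes from the Leibniz rule for the
    divided difference, and so carries a factor $\hbar$. *)
Lemma left_sigmaX i j f :
  left_sigma i (left_poly 'X_j f) =
  left_poly 'X_(sref i j) (left_sigma i f) + delta i j *: f.
Proof.
have -> : delta i j = hbar C * fps_const (nh_delta 1 i j).
  rewrite /nh_delta; case: ifP => _; first by rewrite mulr1.
  case: ifP => _; last by rewrite fps_const0 mulr0.
  rewrite -mulrN1; congr (_ * _); apply/funext => n.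
  by rewrite /fps_const; case: n => //= n; rewrite -[RHS]oppr0.
rewrite !left_sigma.unlock (linear_propD (left_poly_linear _)).
rewrite (linear_propZ (left_poly_linear _)) -scalerA -addrA -scalerDr.
congr (_ + _ *: _); apply/funext => n.
  by rewrite /left_poly /fps_map /= twistX.
by rewrite fps_addE fps_const_scaleE /left_poly /fps_map /= diff_actX.
Qed.

Lemma left_sigma_elt0 i w :
  left_sigma i (E 0%MM w) =
  if (ninv w < ninv (sref i * w))%N then E 0%MM (sref i * w)%g else 0.
Proof.
rewrite left_sigma.unlock fps_map_const; last exact: twist_linear.
rewrite fps_map_const; last exact: diff_act_linear.
rewrite diff_act_elt0 fps_const0 scaler0 addr0 twist_elt0.
by case: ifP => // _; apply: fps_const0.
Qed.

(** Divided differences kill $1 \otimes w$, so only the $T_i$ act. One step that fails to lengthen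
    gives 0, and the total length can then no longer be reached. The outcome depends only on the
    size and the permutation of the word. *)
Lemma left_sigma_word_elt0 r w :
  foldr left_sigma (E 0%MM w) r =
  if ninv (word_perm r * w) == (size r + ninv w)%N
  then E 0%MM (word_perm r * w)%g else 0.
Proof.
elim: r => [|i r IHr] /=; first by rewrite word_perm_nil mul1g eqxx.
rewrite IHr word_perm_cons -mulgA.
have le := inv_word_perm_le r w.
case: eqP => [Er|nEr].
  rewrite left_sigma_elt0; case: (inv_srefP i (word_perm r * w)) => -[_].
    by move=> ->; rewrite ltnSn Er addSn eqxx.
  rewrite Er; move: (ninv (sref i * _)) => x Ex.
  by rewrite Ex ltnNge leqnSn /=; case: eqP => //; lia.
rewrite (linear_prop0 (@left_sigma_linear i)).
case: (inv_srefP i (word_perm r * w)) => -[_]; move: le nEr;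
  move: (ninv (sref i * _)) (ninv (word_perm r * w)) => x y;
  by case: eqP => //; lia.
Qed.

(** The remainders [R] are common to both maps, so they cancel in the difference, which thus
    commutes with the variables up to [s]; induction on the monomial reduces to $1 \otimes w$. *)
Lemma twisted_ext (F G : M -> M) (s : 'I_k -> 'I_k) (R : 'I_k -> M -> M) :
  linear F -> linear G ->
  (forall j f, F (left_poly 'X_j f) = left_poly 'X_(s j) (F f) + R j f) ->
  (forall j f, G (left_poly 'X_j f) = left_poly 'X_(s j) (G f) + R j f) ->
  (forall w, F (E 0%MM w) = G (E 0%MM w)) -> F = G.
Proof.
move=> linF linG FX GX FG; apply: nhfps_ext => // a w.
elim/mnm_ind: a => [|j a IHa]; first exact: FG.
by rewrite -left_poly_elt FX GX IHa.
Qed.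

(** This sign makes the two remainders of $\sigma_i^2$ cancel. *)
Lemma delta_sref i j : delta i (sref i j) = - delta i j.
Proof.
have [->|jl] := eqVneq j (lo i).
  by rewrite sref_lo nh_delta_hi nh_delta_lo.
have [->|jh] := eqVneq j (hi i).
  by rewrite sref_hi nh_delta_hi nh_delta_lo opprK.
by rewrite sref_neq // nh_delta_neq // oppr0.
Qed.

Lemma left_sigma_sq i f : left_sigma i (left_sigma i f) = 0.
Proof.
have lin := @left_sigma_linear i.
suff /(congr1 (@^~ f)) : left_sigma i \o left_sigma i = (fun=> 0) by [].
apply: (@twisted_ext _ _ id (fun _ _ => 0)).
- exact: linear_comp.
- exact: linear_cst0.
- move=> j g; rewrite /= left_sigmaX (linear_propD lin) (linear_propZ lin).
  by rewrite left_sigmaX srefK delta_sref scaleNr addrNK addr0.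
- by move=> j g; rewrite (linear_prop0 (left_poly_linear _)) addr0.
move=> w; rewrite -[LHS]/(foldr left_sigma (E 0%MM w) [:: i; i]).
rewrite left_sigma_word_elt0 !word_perm_cons word_perm_nil mulg1 sref_sq mul1g.
(* A nonzero value would require the length of [w] to exceed itself by two. *)
by case: eqP => //= /eqP; rewrite -[X in X == _]add0n eqn_add2r.
Qed.

Lemma left_sigma_braid i (j : 'I_k.-1) f : j = i.+1 :> nat ->
  left_sigma i (left_sigma j (left_sigma i f)) =
  left_sigma j (left_sigma i (left_sigma j f)).
Proof.
move=> ij; have lini := @left_sigma_linear i; have linj := @left_sigma_linear j.
pose F i j f := left_sigma i (left_sigma j (left_sigma i f)).
suff /(congr1 (@^~ f)) : F i j = F j i by [].
(* Three remainders arise; the middle one contains $\sigma_{i'}^2$ and vanishes. *)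
have FX i' j' m g : F i' j' (left_poly 'X_m g) =
    left_poly 'X_(sref i' (sref j' (sref i' m))) (F i' j' g) +
    (delta i' (sref j' (sref i' m)) *: left_sigma j' (left_sigma i' g) +
     delta i' m *: left_sigma i' (left_sigma j' g)).
  have lini' := @left_sigma_linear i'; have linj' := @left_sigma_linear j'.
  rewrite /F left_sigmaX (linear_propD linj') (linear_propZ linj') left_sigmaX.
  rewrite !(linear_propD lini') !(linear_propZ lini') left_sigmaX.
  by rewrite left_sigma_sq scaler0 addr0 addrA.
have s3 m : sref i (sref j (sref i m)) = sref j (sref i (sref j m)).
  by have /permP/(_ m) := sref_braid ij; rewrite !permM.
(* Applying $s_i$ and then $s_j$ carries the positions j, j+1 to i, i+1, and the opposite order
   carries them back. Hence both sides of the braid relation have the same remainders. *)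
have deltaE m : delta i (sref j (sref i m)) = delta j m /\
                delta j (sref i (sref j m)) = delta i m.
  split; rewrite /nh_delta -!val_eqE /= !val_sref ij;
    do !(case: eqP => //=; try lia).
apply: (@twisted_ext _ _ (fun m => sref i (sref j (sref i m)))
  (fun m g => delta j m *: left_sigma j (left_sigma i g) +
              delta i m *: left_sigma i (left_sigma j g))).
- by apply: linear_comp => //; apply: linear_comp.
- by apply: linear_comp => //; apply: linear_comp.
- by move=> m g; rewrite FX (proj1 (deltaE m)).
- move=> m g; rewrite FX (proj2 (deltaE m)) s3; congr (_ + _); exact: addrC.
move=> w; rewrite -[LHS]/(foldr left_sigma (E 0%MM w) [:: i; j; i]).
rewrite -[RHS]/(foldr left_sigma (E 0%MM w) [:: j; i; j]).
rewrite !left_sigma_word_elt0 !word_perm_cons word_perm_nil !mulg1.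
by rewrite sref_braid.
Qed.

Lemma left_sigma_comm i (j : 'I_k.-1) f : (i.+1 < j)%N || (j.+1 < i)%N ->
  left_sigma i (left_sigma j f) = left_sigma j (left_sigma i f).
Proof.
move=> ij; pose F i j f := left_sigma i (left_sigma j f).
suff /(congr1 (@^~ f)) : F i j = F j i by [].
have FX i' j' m g : F i' j' (left_poly 'X_m g) =
    left_poly 'X_(sref i' (sref j' m)) (F i' j' g) +
    (delta i' (sref j' m) *: left_sigma j' g + delta j' m *: left_sigma i' g).
  have lini' := @left_sigma_linear i'.
  rewrite /F left_sigmaX (linear_propD lini') (linear_propZ lini') left_sigmaX.
  by rewrite addrA.
have s2 m : sref i (sref j m) = sref j (sref i m).
  by have /permP/(_ m) := sref_comm ij; rewrite !permM.
(* Each of the two reflections fixes the positions exchanged by the other. *)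
have deltaE m : delta i (sref j m) = delta i m /\
                delta j (sref i m) = delta j m.
  split; rewrite /nh_delta -!val_eqE /= !val_sref;
    do !(case: eqP => //=; try lia).
apply: (@twisted_ext _ _ (fun m => sref i (sref j m))
  (fun m g => delta i m *: left_sigma j g + delta j m *: left_sigma i g)).
- by apply: linear_comp; apply: left_sigma_linear.
- by apply: linear_comp; apply: left_sigma_linear.
- by move=> m g; rewrite FX (proj1 (deltaE m)).
- move=> m g; rewrite FX (proj2 (deltaE m)) s2; congr (_ + _); exact: addrC.
move=> w; rewrite -[LHS]/(foldr left_sigma (E 0%MM w) [:: i; j]).
rewrite -[RHS]/(foldr left_sigma (E 0%MM w) [:: j; i]).
rewrite !left_sigma_word_elt0 !word_perm_cons word_perm_nil !mulg1.
by rewrite sref_comm.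
Qed.

End Operators.

(** * The nilHecke product *)

(** An arbitrary choice, immaterial for the operators by [left_sigma_reduced]. *)
Definition red_word (k : nat) (w : 'S_k) : seq 'I_k.-1 :=
  sval (cid (exists_reduced w)).

HB.lock Definition const_mul (C : idomainType) (k : nat) (u : nhmod C k)
    (g : fps (nhmod C k)) : fps (nhmod C k) :=
  \sum_w left_poly (u w) (foldr (@left_sigma C k) g (red_word w)).

(** The extension of [const_mul] to series in the left factor: [f i] comes with $\hbar^i$, so only
    finitely many terms reach the coefficient of $\hbar^n$. *)
HB.lock Definition nh_mul (C : idomainType) (k : nat)
    (f g : fps (nhmod C k)) : fps (nhmod C k) :=
  fun n => \sum_(i < n.+1) const_mul (f i) g (n - i)%N.

Section Mul.
Variables (C : idomainType) (k : nat).
Local Notation V := (nhmod C k).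
Local Notation M := (fps V).
Local Notation E := (fun a w => fps_const (nh_elt C a w) : M).
Local Notation left_sigma := (@left_sigma C k).
Local Notation nh_mul := (@nh_mul C k).
Local Notation one := (nh_one E).
Implicit Types (f g : M) (w : 'S_k) (i : 'I_k.-1).

Lemma red_wordP w : reduced w (red_word w).
Proof. exact: (svalP (cid (exists_reduced w))). Qed.

Lemma left_sigma_reduced w r r' g : reduced w r -> reduced w r' ->
  foldr left_sigma g r = foldr left_sigma g r'.
Proof.
apply: reduced_foldr => i j ij x; first exact: left_sigma_braid.
by apply: left_sigma_comm; rewrite ij.
Qed.

Lemma const_mul_elt a w g :
  const_mul (nh_elt C a w) g =
  left_poly 'X_[a] (foldr left_sigma g (red_word w)).
Proof.
rewrite const_mul.unlock (bigD1 w) //= big1 ?addr0 ?ffunE ?eqxx // => w' ne.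
rewrite ffunE (negbTE ne); apply/funext => n.
exact: (linear_prop0 (poly_act_linearl _)).
Qed.

Lemma const_mul_linear (u : V) : linear (const_mul u).
Proof.
move=> c f g; rewrite const_mul.unlock scaler_sumr -big_split.
apply: eq_bigr => w _.
by rewrite (linear_foldr _ (@left_sigma_linear C k)) left_poly_linear.
Qed.

(** Stated coefficientwise because [u] ranges over a module over [C], whereas the values lie in a
    module over [fps C]. *)
Lemma const_mul_linearl g c (u v : V) n :
  const_mul (c *: u + v) g n = c *: const_mul u g n + const_mul v g n.
Proof.
have lin : linear (fun u => const_mul u g n).
  have coef (F : 'S_k -> M) : (\sum_w F w) n = \sum_w F w n.
    by elim/big_rec2: _ => // w x y _ <-.
  move=> a x y; rewrite const_mul.unlock !coef scaler_sumr -big_split.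
  by apply: eq_bigr => w _; rewrite !ffunE; apply: poly_act_linearl.
exact: lin.
Qed.

Lemma const_mul0 g : const_mul 0 g = 0.
Proof.
apply/funext => n; have := const_mul_linearl g (-1) 0 0 n.
by rewrite scaler0 addr0 scaleN1r addNr.
Qed.

Lemma nh_mul_const (u : V) g : nh_mul (fps_const u) g = const_mul u g.
Proof.
apply/funext => n; rewrite nh_mul.unlock big_ord_recl subn0.
rewrite big1 ?addr0 // => i _.
by rewrite /fps_const /= const_mul0.
Qed.

Lemma nh_mul_linear f : linear (nh_mul f).
Proof.
move=> c g g'; apply/funext => n.
rewrite nh_mul.unlock fps_addE fps_scaleE /=.
under [X in _ = X + _]eq_bigr => i _ do rewrite scaler_sumr.
under [LHS]eq_bigr => i _ do rewrite const_mul_linear fps_addE fps_scaleE.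
rewrite big_split /=; congr (_ + _).
(* Both sides are sums over triples of indices with total [n]; reversing the inner, respectively
   outer, index brings them to the two forms of [triangular_sum]. *)
have T := Defs.triangular_sum (fun a b d => c d *: const_mul (f a) g b) n.
transitivity (\sum_(j < n.+1) \sum_(l < (n - j).+1)
    c (n - j - l)%N *: const_mul (f j) g l).
  apply: eq_bigr => j _; rewrite (reindex_inj rev_ord_inj) /=.
  apply: eq_bigr => l _; rewrite subSS; congr (c _ *: _ _).
  by rewrite subKn // -ltnS.
rewrite -T (reindex_inj rev_ord_inj) /=; apply: eq_bigr => i _.
rewrite !subSS; apply: eq_bigr => j _.
by rewrite subKn // -ltnS.
Qed.

Lemma nh_mul_linearl g : linear (nh_mul ^~ g).
Proof.
move=> c f f'; apply/funext => n.
rewrite nh_mul.unlock fps_addE fps_scaleE /=.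
under [X in _ = X + _]eq_bigr => i _ do rewrite scaler_sumr.
rewrite -(Defs.triangular_sum (fun a b d => c a *: const_mul (f b) g d)).
rewrite -big_split.
apply: eq_bigr => i _; rewrite fps_addE fps_scaleE.
have lin : linear (fun u => const_mul u g (n - i)%N).
  by move=> a u v; apply: const_mul_linearl.
rewrite (linear_propD lin) (linear_prop_sum lin) /=; congr (_ + _).
by apply: eq_bigr => j _; rewrite (linear_propZ lin).
Qed.

Lemma nh_mul_elt a w g :
  nh_mul (E a w) g = left_poly 'X_[a] (foldr left_sigma g (red_word w)).
Proof. by rewrite nh_mul_const const_mul_elt. Qed.

Lemma nh_mul_left_poly b f g :
  nh_mul (left_poly 'X_[b] f) g = left_poly 'X_[b] (nh_mul f g).
Proof.
suff /(congr1 (@^~ f)) : nh_mul^~ g \o left_poly 'X_[b] =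
  left_poly 'X_[b] \o nh_mul^~ g by [].
apply: nhfps_ext => [||a w /=].
- by apply: linear_comp; [exact: nh_mul_linearl|exact: left_poly_linear].
- by apply: linear_comp; [exact: left_poly_linear|exact: nh_mul_linearl].
by rewrite left_poly_elt !nh_mul_elt mpolyXD left_polyM.
Qed.

(** Checked on basis elements [f]. For [a = 0], an ascent allows [i] to be prefixed to the reduced
    word, by independence of that word; at a descent both sides vanish, the right one by $\sigma_i^2
    = 0$. Variables are then added with [left_sigmaX]. *)
Lemma nh_mul_left_sigma i f g :
  nh_mul (left_sigma i f) g = left_sigma i (nh_mul f g).
Proof.
have lin := @left_sigma_linear C k i.
suff /(congr1 (@^~ f)) : nh_mul^~ g \o left_sigma i =
  left_sigma i \o nh_mul^~ g by [].
apply: nhfps_ext => [||a w /=].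
- by apply: linear_comp => //; exact: nh_mul_linearl.
- by apply: linear_comp => //; exact: nh_mul_linearl.
elim/mnm_ind: a => [|j a IHa].
  rewrite left_sigma_elt0 [in RHS]nh_mul_elt mpolyX0 left_poly1.
  case: (inv_srefP i w) => -[lt Ew].
    rewrite Ew ltnSn nh_mul_elt mpolyX0 left_poly1.
    rewrite -[RHS]/(foldr left_sigma g (i :: red_word w)).
    apply: (left_sigma_reduced _ (red_wordP _)); apply: cons_reduced.
      by rewrite !permM sref_lo sref_hi.
    by rewrite mul_srefK; apply: red_wordP.
  rewrite Ew ltnNge leqnSn (linear_prop0 (nh_mul_linearl g)).
  have red := cons_reduced lt (red_wordP _).
  by rewrite (left_sigma_reduced g (red_wordP w) red) /= left_sigma_sq.
rewrite -left_poly_elt left_sigmaX (linear_propD (nh_mul_linearl g)).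
rewrite (linear_propZ (nh_mul_linearl g)) !nh_mul_left_poly IHa.
by rewrite left_sigmaX.
Qed.

Lemma nh_mulA : associative nh_mul.
Proof.
move=> f g m.
suff /(congr1 (@^~ f)) : nh_mul^~ (nh_mul g m) = nh_mul^~ m \o nh_mul^~ g by [].
apply: nhfps_ext => [||a w /=].
- exact: nh_mul_linearl.
- by apply: linear_comp; exact: nh_mul_linearl.
rewrite !nh_mul_elt nh_mul_left_poly; congr left_poly.
by elim: (red_word w) => //= i r ->; rewrite nh_mul_left_sigma.
Qed.

Lemma left_sigma_reduced_one w r : reduced w r ->
  foldr left_sigma one r = E 0%MM w.
Proof.
move=> [rw rs]; rewrite left_sigma_word_elt0 mulg1 rw.
by rewrite rs inv1 addn0 eqxx.
Qed.

Lemma nh_mul1l : left_id one nh_mul.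
Proof.
move=> f; rewrite nh_mul_elt mpolyX0 left_poly1.
apply: (left_sigma_reduced (r' := [::]) _ (red_wordP _)).
by split; rewrite ?word_perm_nil ?inv1.
Qed.

Lemma nh_mul1r : right_id one nh_mul.
Proof.
move=> f; suff /(congr1 (@^~ f)) : nh_mul^~ one = id by [].
apply: nhfps_ext => [||a w]; [exact: nh_mul_linearl|by []|].
rewrite nh_mul_elt (left_sigma_reduced_one (red_wordP w)) left_poly_elt.
by rewrite addmC add0m.
Qed.

Lemma nh_mul_X j f : nh_mul (nh_X E j) f = left_poly 'X_j f.
Proof.
rewrite -[in RHS](nh_mul1l f) -nh_mul_left_poly left_poly_elt.
by rewrite addmC add0m.
Qed.

Lemma nh_mul_sigma i f : nh_mul (nh_sigma E i) f = left_sigma i f.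
Proof.
rewrite -[in RHS](nh_mul1l f) -nh_mul_left_sigma left_sigma_elt0 mulg1.
by case: (inv_srefP i 1) => -[]; rewrite inv1 mulg1 ?perm1 ?ltnn //= => _ ->.
Qed.

Lemma nh_mul_algebra : is_algebra one nh_mul.
Proof.
split; [split|exact: nh_mulA|exact: nh_mul1l|exact: nh_mul1r].
- exact: nh_mul_linear.
- exact: nh_mul_linearl.
Qed.

Lemma nh_mul_is_NH : is_NH nh_mul.
Proof.
have sX i j : nh_mul (nh_sigma E i) (nh_X E j) =
    nh_mul (nh_X E (sref i j)) (nh_sigma E i) +
    nh_delta (hbar C) i j *: one.
  rewrite nh_mul_X nh_mul_sigma -[nh_X E j]nh_mul1r nh_mul_X left_sigmaX.
  by rewrite -nh_mul_sigma nh_mul1r.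
(* Each relation among the generators is the corresponding operator relation evaluated at [one]. *)
have s1 i : nh_sigma E i = left_sigma i one by rewrite -nh_mul_sigma nh_mul1r.
split; first exact: nh_mul_algebra.
- split.
  + move=> i j; rewrite !nh_mul_X !left_poly_elt.
    by rewrite addmC.
  + by move=> i; rewrite sX sref_lo nh_delta_lo.
  + by move=> i; rewrite sX sref_hi nh_delta_hi scaleNr.
  + by move=> i j jl jh; rewrite sX sref_neq // nh_delta_neq // scale0r addr0.
  + by move=> i; rewrite nh_mul_sigma s1 left_sigma_sq.
  + move=> i j ij; rewrite -!nh_mulA !nh_mul_sigma !s1.
    exact: left_sigma_braid.
  + by move=> i j ij; rewrite !nh_mul_sigma !s1; apply: left_sigma_comm.
move=> a w r /reducedP red.
have -> : nh_product E nh_mul [seq nh_sigma E i | i <- r] = E 0%MM w.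
  rewrite -(left_sigma_reduced_one red) /nh_product.
  by elim: r {red} => //= i r ->; rewrite nh_mul_sigma.
have -> : nh_Xpow E nh_mul a = left_poly 'X_[a] one.
  elim/mnm_ind: a => [|j a IHa]; first by rewrite nh_Xpow0 mpolyX0 left_poly1.
  rewrite mpolyXD left_polyM -IHa -nh_mul_X; apply/esym.
  apply: (nh_product_X nh_mul_algebra) => [i l||].
  - by rewrite !nh_mul_X !left_poly_elt addmC.
  - exact: enum_uniq.
  - by rewrite mem_enum.
by rewrite nh_mul_left_poly nh_mul1l left_poly_elt addmC add0m.
Qed.

End Mul.

(** * Reduction modulo hbar *)

Definition nh_mul0 (C : idomainType) (k : nat) (a b : nhmod C k) : nhmod C k :=
  nh_mul (fps_const a) (fps_const b) 0%N.

Section Reduction.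
Variables (C : idomainType) (k : nat).
Local Notation V := (nhmod C k).
Local Notation M := (fps V).
Local Notation e := (@nh_elt C k).
Local Notation E := (fun a w => fps_const (nh_elt C a w) : M).
Local Notation nh_mul := (@nh_mul C k).
Local Notation nh_mul0 := (@nh_mul0 C k).

Lemma nh_mul_reduces (f g : M) : nh_mul f g 0%N = nh_mul0 (f 0%N) (g 0%N).
Proof.
rewrite /nh_mul0 nh_mul_const (fps_linear_coef g _ (nh_mul_linear f)) big_ord1.
by rewrite nh_mul.unlock big_ord1.
Qed.

Lemma nh_mul0_algebra : is_algebra (nh_one e) nh_mul0.
Proof.
split; [split|..].
- move=> a c u v; rewrite /nh_mul0 fps_const_linear nh_mul_linear.
  by rewrite fps_addE fps_const_scaleE.
- move=> b c u v; rewrite /nh_mul0 fps_const_linear nh_mul_linearl.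
  by rewrite fps_addE fps_const_scaleE.
- move=> a b c; transitivity
    (nh_mul (fps_const a) (nh_mul (fps_const b) (fps_const c)) 0%N).
    by rewrite nh_mul_reduces.
  by rewrite nh_mulA nh_mul_reduces.
- by move=> a; rewrite /nh_mul0 (nh_mul1l (fps_const a)).
- by move=> a; rewrite /nh_mul0 (nh_mul1r (fps_const a)).
Qed.

Lemma nh_product_reduces (s : seq V) :
  nh_product E nh_mul [seq fps_const v | v <- s] 0%N = nh_product e nh_mul0 s.
Proof. by elim: s => //= v s IHs; rewrite nh_mul_reduces IHs. Qed.

(** Each condition is the constant coefficient of the one for [nh_mul], where the multiples of
    $\hbar$ disappear. *)
Lemma nh_mul0_is_NH0 : is_NH0 nh_mul0.
Proof.
have [_ rel basis] := nh_mul_is_NH C k.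
split; first exact: nh_mul0_algebra.
- split.
  + by move=> i j; have := congr1 (@^~ 0%N) (nh_XX rel i j).
  + move=> i; have := congr1 (@^~ 0%N) (nh_sigma_lo rel i).
    by rewrite /= fps_addE hbar_scaleE scale0r.
  + move=> i; have := congr1 (@^~ 0%N) (nh_sigma_hi rel i).
    by rewrite /= -scalerN fps_addE hbar_scaleE scale0r subr0 addr0.
  + by move=> i j jl jh; have := congr1 (@^~ 0%N) (nh_sigma_X rel jl jh).
  + by move=> i; have := congr1 (@^~ 0%N) (nh_sigma_sq rel i).
  + move=> i j ij; have := congr1 (@^~ 0%N) (nh_braid rel ij).
    by rewrite /= !nh_mul_reduces.
  + by move=> i j ij; have := congr1 (@^~ 0%N) (nh_sigma_comm rel ij).
move=> a w r red.
rewrite -[RHS]/(fps_const (nh_elt C a w) 0%N) -(basis a w r red).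
rewrite nh_mul_reduces /nh_Xpow -!nh_product_reduces map_flatten -!map_comp.
congr (nh_mul0 (nh_product E _ _ _) _).
by congr flatten; apply: eq_map => i /=; rewrite map_nseq.
Qed.

Lemma NH0_unique (mul mul' : V -> V -> V) :
  is_NH0 mul -> is_NH0 mul' -> mul = mul'.
Proof. exact/NilHecke_unique/nhmod_ext. Qed.

Lemma NH_unique (mul mul' : M -> M -> M) :
  is_NH mul -> is_NH mul' -> mul = mul'.
Proof. exact/NilHecke_unique/nhfps_ext. Qed.

End Reduction.

(** * The grading *)

Section Grading.
Variables (C : idomainType) (k : nat).
Local Notation V := (nhmod C k).
Local Notation M := (fps V).
Local Notation e := (@nh_elt C k).
Implicit Types (v : V) (w : 'S_k) (d : int * int) (f g : M).

(** The degree forced on $X^a\sigma_w$: $(1,1)$ for each letter of a reduced word and $(-1,0)$ for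
    each variable. *)
Definition nh_degree (a : 'X_{1..k}) w : int * int :=
  ((ninv w)%:Z - (mdeg a)%:Z, (ninv w)%:Z).

Definition nh_gr d v : Prop := forall a w, (v w)@_a != 0 -> nh_degree a w = d.

Lemma nh_gr_ind (P : V -> Prop) d v :
  P 0 -> (forall c u u', P u -> P u' -> P (c *: u + u')) ->
  (forall a w, nh_degree a w = d -> P (e a w)) -> nh_gr d v -> P v.
Proof. by move=> P0 PD Pe gv; apply: nhmod_ind => // a w /gv; apply: Pe. Qed.

Lemma nh_gr0 d : nh_gr d 0.
Proof. by move=> a w; rewrite ffunE mcoeff0 eqxx. Qed.

Lemma nh_gr_linear d c u v : nh_gr d u -> nh_gr d v -> nh_gr d (c *: u + v).
Proof.
move=> gu gv a w; rewrite !ffunE mcoeffD mcoeffZ.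
have [u0|/gu //] := eqVneq (u w)@_a 0.
by rewrite u0 mulr0 add0r; apply: gv.
Qed.

Lemma nh_grD d u v : nh_gr d u -> nh_gr d v -> nh_gr d (u + v).
Proof. by move=> gu gv; rewrite -[u]scale1r; apply: nh_gr_linear. Qed.

Lemma nh_gr_elt a w : nh_gr (nh_degree a w) (e a w).
Proof.
move=> b u; rewrite ffunE; case: (u =P w) => [->|_]; last first.
  by rewrite mcoeff0 eqxx.
by rewrite mcoeffX; case: (a =P b) => [->|_] //; rewrite eqxx.
Qed.

Lemma int_pair_eq d d' : d.1 = d'.1 -> d.2 = d'.2 -> d = d'.
Proof. by case: d d' => [x y] [x' y'] /= -> ->. Qed.

Lemma nh_degreeX j a w : nh_degree (U_(j) + a)%MM w = nh_degree a w + (-1, 0).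
Proof. by apply: int_pair_eq; rewrite /= ?mdegD ?mdeg1; lia. Qed.

Lemma nh_gr_X d j v : nh_gr d v -> nh_gr (d + (-1, 0)) (poly_act 'X_j v).
Proof.
have lin := poly_act_linear ('X_j : {mpoly C[k]}).
apply: (nh_gr_ind (P := fun v => nh_gr _ (poly_act 'X_j v))).
- by rewrite (linear_prop0 lin); apply: nh_gr0.
- by move=> c u u' gu gu'; rewrite lin; apply: nh_gr_linear.
move=> a w <-; rewrite poly_act_elt -(nh_degreeX j); exact: nh_gr_elt.
Qed.

Lemma nh_gr_twist d i v : nh_gr d v -> nh_gr (d + (1, 1)) (twist i v).
Proof.
have lin := @twist_linear C k i.
apply: (nh_gr_ind (P := fun v => nh_gr _ (twist i v))).
- by rewrite (linear_prop0 lin); apply: nh_gr0.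
- by move=> c u u' gu gu'; rewrite lin; apply: nh_gr_linear.
move=> a w <-; elim/mnm_ind: a => [|j a IHa].
  rewrite twist_elt0; case: (inv_srefP i w) => -[_ Ew]; last first.
    by rewrite Ew ltnNge leqnSn; apply: nh_gr0.
  rewrite Ew ltnSn.
  suff -> : nh_degree 0 w + (1, 1) = nh_degree 0 (sref i * w)%g.
    exact: nh_gr_elt.
  by apply: int_pair_eq; rewrite /= Ew; lia.
by rewrite -poly_act_elt twistX nh_degreeX addrAC; apply: nh_gr_X.
Qed.

Lemma nh_gr_diff d i v : nh_gr d v -> nh_gr (d + (1, 0)) (diff_act i v).
Proof.
have lin := @diff_act_linear C k i.
apply: (nh_gr_ind (P := fun v => nh_gr _ (diff_act i v))).
- by rewrite (linear_prop0 lin); apply: nh_gr0.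
- by move=> c u u' gu gu'; rewrite lin; apply: nh_gr_linear.
move=> a w <-; elim/mnm_ind: a => [|j a IHa].
  by rewrite diff_act_elt0; apply: nh_gr0.
rewrite -poly_act_elt diff_actX nh_degreeX addrAC.
apply: nh_grD; first exact: nh_gr_X.
rewrite -[_ *: _]addr0; apply: nh_gr_linear; last exact: nh_gr0.
(* The Leibniz remainder is a multiple of the original element: lowering by the divided difference
   and the factor $X_j$ balance. *)
suff -> : nh_degree a w + (1, 0) + (-1, 0) = nh_degree a w.
  exact: nh_gr_elt.
by apply: int_pair_eq => /=; lia.
Qed.

(** Homogeneity in the total degree, where $\hbar$ counts as $(0,1)$. *)
Definition fps_gr d f : Prop := forall n, nh_gr (d - (0, n%:Z)) (f n).

Lemma fps_gr0 d : fps_gr d 0.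
Proof. by move=> n; apply: nh_gr0. Qed.

Lemma fps_gr_const d v : nh_gr d v -> fps_gr d (fps_const v).
Proof.
move=> gv [|n]; rewrite /fps_const /=; last exact: nh_gr0.
by suff -> : d - (0, 0%:Z) = d by []; apply: int_pair_eq => /=; lia.
Qed.

Lemma fps_gr_poly d a f : fps_gr d f ->
  fps_gr (d + (- (mdeg a)%:Z, 0)) (left_poly 'X_[a] f).
Proof.
move=> gf; elim/mnm_ind: a => [|j a IHa].
  rewrite mpolyX0 left_poly1 mdeg0; move: gf; congr fps_gr.
  by apply: int_pair_eq => /=; lia.
rewrite mpolyXD left_polyM mdegD mdeg1 => n.
have := nh_gr_X (j := j) (IHa n); congr nh_gr.
by apply: int_pair_eq => /=; lia.
Qed.

Lemma fps_gr_sigma d i f : fps_gr d f -> fps_gr (d + (1, 1)) (left_sigma i f).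
Proof.
move=> gf n; rewrite left_sigma.unlock fps_addE hbar_scaleE addrAC.
apply: nh_grD; first exact: nh_gr_twist.
case: n => [|n]; first exact: nh_gr0.
(* The factor $\hbar$ moves coefficient n to n+1, and $(1,1) - (0,n+1) = (1,0) - (0,n)$. *)
have := nh_gr_diff (i := i) (gf n); congr nh_gr.
by apply: int_pair_eq => /=; lia.
Qed.

Lemma fps_gr_word d r f : fps_gr d f ->
  fps_gr (d + ((size r)%:Z, (size r)%:Z)) (foldr (@left_sigma C k) f r).
Proof.
move=> gf; elim: r => [|i r IHr] /=.
  by move: gf; congr fps_gr; apply: int_pair_eq => /=; lia.
have := fps_gr_sigma (i := i) IHr; congr fps_gr.
by apply: int_pair_eq => /=; lia.
Qed.

Lemma fps_gr_const_mul d d' u g : nh_gr d u -> fps_gr d' g ->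
  fps_gr (d + d') (const_mul u g).
Proof.
move=> gu gg.
apply: (nh_gr_ind (P := fun u => fps_gr (d + d') (const_mul u g)) _ _ _ gu).
- by rewrite const_mul0; apply: fps_gr0.
- move=> c x y gx gy n; rewrite const_mul_linearl.
  exact: nh_gr_linear.
move=> a w <-; rewrite const_mul_elt.
have := fps_gr_poly (a := a) (fps_gr_word (r := red_word w) gg); congr fps_gr.
have [_ ->] := red_wordP w.
by apply: int_pair_eq => /=; lia.
Qed.

Lemma nh_mul_homogeneous d d' (a b : V) : nh_gr d a -> nh_gr d' b ->
  forall n, nh_gr (d + d' - (0, n%:Z)) (nh_mul (fps_const a) (fps_const b) n).
Proof.
move=> ga gb n; rewrite nh_mul_const.
exact: (fps_gr_const_mul ga (fps_gr_const gb)).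
Qed.

(** * Homogeneous components, existence and uniqueness of the grading *)

Definition nh_component v d : V :=
  [ffun w => \sum_(a <- msupp (v w) | nh_degree a w == d) (v w)@_a *: 'X_[a]].

Lemma nh_component_coef v d a w :
  (nh_component v d w)@_a = if nh_degree a w == d then (v w)@_a else 0.
Proof.
rewrite ffunE big_mkcond raddf_sum /=.
have [va|va] := boolP (a \in msupp (v w)); last first.
  rewrite (memN_msupp_eq0 va) if_same big_seq big1 // => b bv.
  case: ifP => _; rewrite ?mcoeff0 // mcoeffZ mcoeffX.
  by case: eqP => [ba|_]; [rewrite -ba bv in va|rewrite mulr0].
rewrite (bigD1_seq a) ?msupp_uniq //= big1 ?addr0 => [|b ba].
  case: ifP => _; last by rewrite mcoeff0.
  by rewrite mcoeffZ mcoeffX eqxx mulr1.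
case: ifP => _; rewrite ?mcoeff0 // mcoeffZ mcoeffX.
by rewrite (negbTE ba) mulr0.
Qed.

Lemma nh_component_gr v d : nh_gr d (nh_component v d).
Proof.
move=> a w; by rewrite nh_component_coef; case: ifP => [/eqP//|_]; rewrite eqxx.
Qed.

Lemma nh_gr_coef0 d v a w : nh_gr d v -> nh_degree a w != d -> (v w)@_a = 0.
Proof. by move=> gv ne; apply/eqP; apply: contraNT ne => /gv ->. Qed.

Lemma sum_coef (I : Type) (s : seq I) (F : I -> V) a w :
  ((\sum_(i <- s) F i) w)@_a = \sum_(i <- s) (F i w)@_a.
Proof. by rewrite sum_ffunE raddf_sum. Qed.

(** The list is enlarged by a prescribed degree [d0], at which the uniqueness argument compares two
    decompositions. *)
Lemma nh_component_sum v d0 : exists s : seq (int * int),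
  [/\ uniq s, d0 \in s & v = \sum_(d <- s) nh_component v d].
Proof.
pose s := undup (d0 :: flatten [seq [seq nh_degree a w | a <- msupp (v w)] |
                               w <- enum 'S_k]).
exists s; split; rewrite ?undup_uniq ?mem_undup ?mem_head //.
apply/ffunP => w; apply/mpolyP => a; rewrite sum_coef.
have [ds|ds] := boolP (nh_degree a w \in s).
  rewrite (bigD1_seq _ ds) ?undup_uniq //= big1 ?addr0 => [|d ne].
    by rewrite nh_component_coef eqxx.
  by rewrite nh_component_coef eq_sym (negbTE ne).
have va : (v w)@_a = 0.
  apply: memN_msupp_eq0; apply: contraNN ds => av.
  rewrite mem_undup inE; apply/orP; right.
  apply/flatten_mapP; exists w; first by rewrite mem_enum.
  by apply/mapP; exists a.
by rewrite va big1 // => d _; rewrite nh_component_coef va if_same.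
Qed.

Lemma nh_gr_grading :
  is_Z2_grading (nh_one e) (@nh_mul0 C k) nh_gr.
Proof.
have deg1 : nh_degree 0%MM 1%g = 0.
  by apply: int_pair_eq; rewrite /= inv1 ?mdeg0.
split.
- exact: nh_gr0.
- exact: nh_gr_linear.
- move=> v; have [s [_ _ vE]] := nh_component_sum v 0.
  by exists s, (nh_component v); split => // d; apply: nh_component_gr.
- move=> s f us gf f0 d ds; apply/ffunP => w; apply/mpolyP => a.
  transitivity (0 : C); last by rewrite ffunE mcoeff0.
  (* The coefficient of $X^a\sigma_w$ can be nonzero in one summand only, so it is read off from the
     vanishing sum. *)
  have [dE|ne] := eqVneq (nh_degree a w) d; last exact: (nh_gr_coef0 (gf d)).
  have := sum_coef s f a w; rewrite f0 ffunE mcoeff0 (bigD1_seq d) //=.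
  rewrite big1 ?addr0 // => d' ne; apply: (nh_gr_coef0 (gf d')).
  by rewrite dE eq_sym.
- by rewrite -deg1; apply: nh_gr_elt.
move=> d d' a b ga gb; have := nh_mul_homogeneous ga gb (n := 0%N).
by congr nh_gr; apply: int_pair_eq => /=; lia.
Qed.

Lemma nh_gr_is_NH_grading : is_NH_grading (@nh_mul0 C k) nh_gr.
Proof.
split; first exact: nh_gr_grading.
- move=> i; have := nh_gr_elt (a := U_(i)%MM) (w := 1%g); congr nh_gr.
  by apply: int_pair_eq; rewrite /= inv1 ?mdeg1.
- move=> i; have := nh_gr_elt (a := 0%MM) (w := sref i); congr nh_gr.
  have E1 : ninv (sref i) = 1%N.
    by rewrite -[sref i]mulg1 inv_ascent ?inv1 // !perm1.
  by apply: int_pair_eq; rewrite /= E1 ?mdeg0.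
Qed.

(** $X^a\sigma_w$ is a product of generators, whose degrees are prescribed and add up. *)
Lemma nh_grading_elt gr a w :
  is_NH_grading (@nh_mul0 C k) gr -> gr (nh_degree a w) (e a w).
Proof.
case=> -[_ _ _ _ gr1 grM] grX grs.
have NH := @nh_mul0_is_NH0 C k.
elim/mnm_ind: a => [|j a IHa]; last first.
  by rewrite -(nh_X_basis NH) nh_degreeX addrC; apply: grM.
have red := red_wordP w; rewrite (nh_sigma_word NH red).
have -> : nh_degree 0%MM w = ((size (red_word w))%:Z, (size (red_word w))%:Z).
  by have [_ ->] := red; apply: int_pair_eq; rewrite /= ?mdeg0; lia.
elim: (red_word w) => [|i r IHr] //=.
exact: (grM _ _ _ _ (grs i) IHr).
Qed.

(* A grading containing the basis elements in the prescribed degrees contains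
   [nh_gr]; since both decompose the module as a direct sum, they agree. *)
Lemma nh_grading_unique gr :
  is_NH_grading (@nh_mul0 C k) gr -> nh_gr = gr.
Proof.
move=> Hgr; have [[gr0 gr_lin _ gr_dir _ _] _ _] := Hgr.
have sub d v : nh_gr d v -> gr d v.
  apply: nh_gr_ind => // [c u u'|a w <-]; first exact: gr_lin.
  exact: nh_grading_elt.
apply/funext => d; apply/funext => v; apply/propext; split; first exact: sub.
move=> gv; have [s [us ds vE]] := nh_component_sum v d.
(* [F] subtracts the decomposition of [v] into components from the one with [v] alone in degree [d].
   Its terms are homogeneous for [gr] and sum to 0, so directness forces [v] to equal its component
   of degree [d]. *)
pose F d' := (if d' == d then v else 0) - nh_component v d'.
have grF d' : gr d' (F d').
  rewrite /F addrC -scaleN1r; apply: gr_lin.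
    by apply: sub; apply: nh_component_gr.
  by case: eqP => [->|_] //; apply: gr0.
have sumF : \sum_(d' <- s) F d' = 0.
  rewrite sumrB -vE (bigD1_seq d) //= eqxx big1 ?addr0 ?subrr // => d'.
  by move/negbTE => ->.
have := gr_dir s F us grF sumF d ds; rewrite /F eqxx => /subr0_eq ->.
exact: nh_component_gr.
Qed.

End Grading.

Theorem lemma4p2 (R : realType) (k : nat) (hk : (0 < k)%N) :
  exists (mul0 : nhmod R[i] k -> nhmod R[i] k -> nhmod R[i] k)
         (mul : fps (nhmod R[i] k) -> fps (nhmod R[i] k) -> fps (nhmod R[i] k))
         (gr : (int * int) -> nhmod R[i] k -> Prop),
    [/\ unique (@is_NH0 R[i] k) mul0,
        unique (@is_NH R[i] k) mul,
        unique (is_NH_grading mul0) gr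
      & is_Z2_graded_deformation mul0 gr mul].
Proof.
exists (@nh_mul0 R[i] k), (@nh_mul R[i] k), (@nh_gr R[i] k); split.
- split; first exact: nh_mul0_is_NH0.
  by move=> mul; apply: NH0_unique; apply: nh_mul0_is_NH0.
- split; first exact: nh_mul_is_NH.
  by move=> mul; apply: NH_unique; apply: nh_mul_is_NH.
- split; [exact: nh_gr_is_NH_grading|exact: nh_grading_unique].
split.
- exact: nh_mulA.
- exact: (alg_bilinear (@nh_mul_algebra _ _)).
- exact: nh_mul_reduces.
- exact: nh_mul_homogeneous.
Qed.
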